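(* (1) The function $1/\zeta$ is strictly concave on $(0,1)$. (2) For all $x\in(0,1)$, $$\zeta(1/2)\le H\big(\zeta(x),\zeta(1-x)\big)<-1,$$ with equality on the left if and only if $x=1/2$; the value $-1$ on the right is attained only in the limiting cases $x=0,1$, i.e. $H(\zeta(x),\zeta(1-x))\to -1$ as $x\to0^+$ and as $x\to 1^-$. (3) For all $x\in(0,1)$, $$\frac{\log 4}{1+\log 4}< H\big(\eta(x),\eta(1-x)\big)\le(1-\sqrt 2)\,\zeta(1/2),$$ with equality on the right if and only if $x=1/2$; the value $\frac{\log 4}{1+\log 4}$ on the left is attained only in the limiting cases $x=0,1$, i.e. $H(\eta(x),\eta(1-x))\to \frac{\log 4}{1+\log 4}$ as $x\to0^+$ and as $x\to1^-$.
   Context: $\zeta$ is the Riemann zeta function (meromorphically continued). $\eta(s)=\sum_{n=1}^\infty\frac{(-1)^{n+1}}{n^s}=(1-2^{1-s})\zeta(s)$ for $s>0$ is the Dirichlet eta function (with $\eta(1)=\log 2$). $H(a,b)=\frac{2ab}{a+b}$ is the harmonic mean of real numbers $a,b$ with $a+b\neq0$. *)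

(* Defs.v *)
From Stdlib Require Import Reals.
From Coquelicot Require Import Coquelicot.

Open Scope R_scope.

Definition Cexp (z : C) : C :=
  (exp (Re z) * cos (Im z), exp (Re z) * sin (Im z)).

Definition analytic_at (f : C -> C) (z : C) : Prop :=
  exists a : nat -> C,
    locally z (fun w : C =>
      @is_pseries C_AbsRing C_NormedModule a (w - z)%C (f w)).

(* Near z, except at z itself, f is given by a Laurent series with a finite
   principal part: f w = (w - z)^-N * \sum_k a_k (w - z)^k. *)
Definition meromorphic_at (f : C -> C) (z : C) : Prop :=
  exists (N : nat) (a : nat -> C),
    locally' z (fun w : C =>
      @is_pseries C_AbsRing C_NormedModule a (w - z)%C (Cpow (w - z) N * f w)%C).

(* The Dirichlet series is indexed from n = 0, and (n + 1)^-s is written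
   exp (- s ln (n + 1)).  These conditions determine zeta s for every s <> 1,
   because C \ {1} is connected; zeta 1 is left arbitrary. *)
Definition is_riemann_zeta (zeta : C -> C) : Prop :=
  (forall s : C, s <> RtoC 1 -> analytic_at zeta s) /\
  meromorphic_at zeta (RtoC 1) /\
  (forall s : C, 1 < Re s ->
     @is_series C_AbsRing C_NormedModule
       (fun n : nat => Cexp (- s * RtoC (ln (INR (n + 1))))%C) (zeta s)).

(* The Riemann zeta function is real on R \ {1}, so taking the real part only
   changes the type. *)
Definition on_reals (f : C -> C) (x : R) : R := Re (f (RtoC x)).

(* The sum is indexed from n = 0, so the sign (-1)^(n+2) becomes (-1)^n. *)
Definition dirichlet_eta (s : R) : R :=
  Series (fun n : nat => (-1) ^ n / Rpower (INR (n + 1)) s).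

Definition harmonic_mean (a b : R) : R := 2 * a * b / (a + b).

Definition strictly_concave_on (a b : R) (f : R -> R) : Prop :=
  forall x y t : R,
    a < x < b -> a < y < b -> x <> y -> 0 < t < 1 ->
    t * f x + (1 - t) * f y < f (t * x + (1 - t) * y).

(* Main.v *)
Require Import Defs.
From Stdlib Require Import Reals Lra Lia Psatz Classical.
From Coquelicot Require Import Coquelicot.

Open Scope R_scope.

(** Three steps of Euler's transformation turn [eta s] into
    [1 - 7/8 2^-s + 1/2 3^-s - 1/8 4^-s] plus an absolutely convergent alternating sum of third
    differences of [n^-s], [n >= 2].  By the mean value theorem the [s]-derivatives of these third
    differences are third [y]-derivatives of [(- ln y)^k y^-s], and they are small enough for the
    explicit terms to decide the signs: [eta] is concave and strictly increasing on (0,1].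
    Hence [1 / eta] is convex and decreasing, and so is [- 1 / zeta = (2^(1-x) - 1) * (1 / eta)].
    All inequalities follow from this, from [eta 0+ = 1/2] and from [eta 1 = ln 2].
    The relation [eta = (1 - 2^(1-x)) zeta] passes from [x > 1] to (0,1) along the real line
    only: multiplying by [(x - 1)^N] removes the pole, and a real-analytic function on (0, +oo)
    that vanishes for [x > 1] vanishes identically. *)

(** No derivative of eta itself is ever formed. Derivative bounds are proved for the finite sums
    [euler3], uniformly in the number of terms and up to s = 0, where the eta series diverges; only
    inequalities between values pass to the limit. The limit keeps concavity in non-strict form, and
    monotonicity stays strict because all slopes are at least 1/40. This is enough: the strictness
    in the convexity of - 1 / zeta comes from monotonicity alone. The narrow place is the sign of
    the second derivative: eight times the explicit part is shown to be at most - 0.45, and the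
    majorant of the tail costs 0.4. This governs the constant 0.6 in the kernel bounds and the
    precision required of ln 2 and ln 3. *)

(** * Polynomial inequalities for the kernels of the third differences *)

(** Turns an inequality on L >= c into one on m >= 0, where [nra] can use the signs of the powers of
    [m]. *)
Ltac shift_to L c m :=
  let H := fresh in
  set (m := L - c); assert (H : 0 <= m) by (unfold m; lra);
  replace L with (m + c) by (unfold m; ring); clearbody m;
  pose proof (pow_le m 3 H); pose proof (pow_le m 4 H);
  pose proof (pow_le m 5 H); pose proof (pow_le m 6 H).

(* The four [assert]s are the Bernstein coefficients in [s] on [0, 1]. *)
Lemma second_kernel_lower s L : 0 <= s <= 1 -> 69 / 100 <= L ->
  - (6 * (s + 1) - 2 * (3 * s ^ 2 + 6 * s + 2) * L + s * (s + 1) * (s + 2) * L ^ 2) <=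
  6 / 10 * (1 + L + L ^ 2 / 2 + L ^ 3 / 6) * (1 + s * L + (s * L) ^ 2 / 2 + (s * L) ^ 3 / 6).
Proof.
  intros Hs HL.
  set (E := 1 + L + L ^ 2 / 2 + L ^ 3 / 6).
  assert (H0 : 0 <= 6 / 10 * E + 6 - 4 * L).
  { unfold E. shift_to L (69 / 100) m. pose proof (pow2_ge_0 (m - 28 / 10)). nra. }
  assert (H1 : 0 <= 3 * (6 / 10 * E + 6 - 4 * L) + (6 / 10 * E * L + 6 - 12 * L + 2 * L ^ 2)).
  { unfold E. shift_to L (69 / 100) m. pose proof (pow2_ge_0 (m - 157 / 100)). nra. }
  assert (H2 : 0 <= 3 * (6 / 10 * E + 6 - 4 * L) + 2 * (6 / 10 * E * L + 6 - 12 * L + 2 * L ^ 2)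
                    + (6 / 10 * E * L ^ 2 / 2 - 6 * L + 3 * L ^ 2)).
  { unfold E. shift_to L (69 / 100) m.
    (* The polynomial has a minimum of only about 0.5 near m = 0.73, so the squares offered to [nra]
       vanish close to that point. The same holds for [H3], with a minimum of about 0.2 near m =
       0.4. *)
    assert (0 <= m * (m - 73 / 100) ^ 2) by (apply Rmult_le_pos; [lra|apply pow2_ge_0]).
    pose proof (pow2_ge_0 (m - 757 / 1000)). nra. }
  assert (H3 : 0 <= 6 / 10 * E * (1 + L + L ^ 2 / 2 + L ^ 3 / 6) + 12 - 22 * L + 6 * L ^ 2).
  { unfold E. shift_to L (69 / 100) m.
    assert (0 <= m * (m - 4 / 10) ^ 2) by (apply Rmult_le_pos; [lra|apply pow2_ge_0]).
    pose proof (pow2_ge_0 (m - 428 / 1000)). nra. }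
  pose proof (Rmult_le_pos _ _ H0 (pow_le (1 - s) 3 ltac:(lra))).
  pose proof (Rmult_le_pos _ _ H1 (Rmult_le_pos _ _ (proj1 Hs) (pow2_ge_0 (1 - s)))).
  pose proof (Rmult_le_pos _ _ H2 (Rmult_le_pos (1 - s) _ ltac:(lra) (pow2_ge_0 s))).
  pose proof (Rmult_le_pos _ _ H3 (pow_le s 3 ltac:(lra))).
  clearbody E. nra.
Qed.

(** After s^3 L^2 <= s^2 L^2, and without the cubic Taylor term on the right, the two sides compare
    coefficient by coefficient in s. The threshold is just below ln 3. At L = ln 2 and s = 0 the
    inequality fails (about 3.2 against 1.2), so this sign is controlled only from base point 3
    on. *)
Lemma second_kernel_upper s L : 0 <= s <= 1 -> 1098 / 1000 <= L ->
  6 * (s + 1) - 2 * (3 * s ^ 2 + 6 * s + 2) * L + s * (s + 1) * (s + 2) * L ^ 2 <=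
  6 / 10 * (1 + L + L ^ 2 / 2 + L ^ 3 / 6) * (1 + s * L + (s * L) ^ 2 / 2 + (s * L) ^ 3 / 6).
Proof.
  intros Hs HL.
  set (E := 1 + L + L ^ 2 / 2 + L ^ 3 / 6).
  assert (H0 : 0 <= 6 / 10 * E - (6 - 4 * L)).
  { unfold E. shift_to L (1098 / 1000) m. nra. }
  assert (H1 : 0 <= 6 / 10 * E * L - (6 - 12 * L + 2 * L ^ 2)).
  { unfold E. shift_to L (1098 / 1000) m. nra. }
  assert (H2 : 0 <= 6 / 10 * E * L ^ 2 / 2 + 6 * L - 4 * L ^ 2).
  { unfold E. shift_to L (1098 / 1000) m. nra. }
  assert (HE : 0 <= E) by (unfold E; nra).
  pose proof (Rmult_le_pos _ _ H1 (proj1 Hs)).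
  pose proof (Rmult_le_pos _ _ H2 (pow2_ge_0 s)).
  assert (0 <= s ^ 2 * (1 - s) * L ^ 2).
  { apply Rmult_le_pos; [apply Rmult_le_pos; [apply pow2_ge_0|lra]|apply pow2_ge_0]. }
  assert (0 <= E * (s * L) ^ 3) by (apply Rmult_le_pos; [auto|apply pow_le; nra]).
  clearbody E. nra.
Qed.

(** With L = ln y the right side is at most 4 y^s, which cancels the factor y^-s multiplying the
    kernel. *)
Lemma first_kernel_bound s L : 0 <= s <= 1 -> 69 / 100 <= L ->
  Rabs ((3 * s ^ 2 + 6 * s + 2) - s * (s + 1) * (s + 2) * L) <= 4 * (1 + s * L + (s * L) ^ 2 / 2).
Proof.
  intros Hs HL. apply Rabs_le. split.
  - assert (0 <= s * L) by nra.
    assert (0 <= s * (1 - s) * (s * L)) by (apply Rmult_le_pos; nra).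
    pose proof (pow2_ge_0 (s * L - s)). pose proof (pow2_ge_0 s). nra.
  - set (m := L - 69 / 100). assert (0 <= m) by (unfold m; lra).
    replace L with (m + 69 / 100) by (unfold m; ring). clearbody m.
    assert (0 <= s * m) by nra. assert (0 <= s * s * m) by nra.
    assert (0 <= s * s * s * m) by nra. assert (0 <= s * s * s) by nra.
    pose proof (pow2_ge_0 (s * m)). pose proof (pow2_ge_0 s). nra.
Qed.

(** * Third differences of [y^-s] *)

Lemma exp_taylor3 z : 0 <= z -> 1 + z + z ^ 2 / 2 + z ^ 3 / 6 <= exp z.
Proof.
  intros Hz. pose proof (exp_ge_taylor z 3 Hz) as H. simpl in H. simpl. lra.
Qed.

(** This truncates the series of 2 artanh x. The error after three terms has derivative 2 t^6 / (1 -
    t^2), which is positive and, for t < x, below 2 t^6 / (1 - x^2). *)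
Lemma log_ratio_bounds x : 0 < x < 1 ->
  2 * (x + x ^ 3 / 3 + x ^ 5 / 5) < ln ((1 + x) / (1 - x))
    < 2 * (x + x ^ 3 / 3 + x ^ 5 / 5 + x ^ 7 / (7 * (1 - x ^ 2))).
Proof.
  intros Hx.
  set (g := fun t => ln (1 + t) - ln (1 - t) - 2 * (t + t ^ 3 / 3 + t ^ 5 / 5)).
  assert (Hg : exists c, g x - g 0 = 2 * c ^ 6 / (1 - c ^ 2) * (x - 0) /\ 0 < c < x).
  { apply (MVT_cor2 g (fun t => 2 * t ^ 6 / (1 - t ^ 2))); [lra|].
    intros c Hc. apply is_derive_Reals. unfold g. auto_derive.
    - repeat split; lra.
    - field. repeat split; nra. }
  set (h := fun t => ln (1 + t) - ln (1 - t) - 2 * (t + t ^ 3 / 3 + t ^ 5 / 5)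
     - 2 * t ^ 7 / (7 * (1 - x ^ 2))).
  assert (Hh : exists c, h x - h 0 =
     (2 * c ^ 6 / (1 - c ^ 2) - 2 * c ^ 6 / (1 - x ^ 2)) * (x - 0) /\ 0 < c < x).
  { apply (MVT_cor2 h (fun t => 2 * t ^ 6 / (1 - t ^ 2) - 2 * t ^ 6 / (1 - x ^ 2))); [lra|].
    intros c Hc. apply is_derive_Reals. unfold h. auto_derive.
    - repeat split; try lra.
    - field. repeat split; nra. }
  assert (L0 : ln (1 + 0) = 0) by (rewrite Rplus_0_r; apply ln_1).
  assert (L1 : ln (1 - 0) = 0) by (rewrite Rminus_0_r; apply ln_1).
  rewrite ln_div by lra. split.
  - destruct Hg as (c & Hc & Hcx).
    assert (0 < 2 * c ^ 6 / (1 - c ^ 2) * (x - 0)).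
    { apply Rmult_lt_0_compat; [|lra]. apply Rdiv_lt_0_compat; [|nra].
      apply Rmult_lt_0_compat; [lra|apply pow_lt; lra]. }
    unfold g in Hc. rewrite L0, L1 in Hc. lra.
  - destruct Hh as (c & Hc & Hcx).
    assert (0 < (2 * c ^ 6 / (1 - x ^ 2) - 2 * c ^ 6 / (1 - c ^ 2)) * (x - 0)).
    { apply Rmult_lt_0_compat; [|lra]. apply Rlt_0_minus.
      apply Rmult_lt_compat_l; [apply Rmult_lt_0_compat; [lra|apply pow_lt; lra]|].
      assert (0 < 1 - x ^ 2 < 1 - c ^ 2) by nra.
      apply Rinv_lt_contravar; [apply Rmult_lt_0_compat|]; lra. }
    unfold h in Hc. rewrite L0, L1 in Hc.
    replace (x ^ 7 / (7 * (1 - x ^ 2))) with (2 * x ^ 7 / (7 * (1 - x ^ 2)) / 2)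
      by (field; nra).
    replace (0 - 0 - 2 * (0 + 0 ^ 3 / 3 + 0 ^ 5 / 5) - 2 * 0 ^ 7 / (7 * (1 - x ^ 2))) with 0 in
      Hc by (field; nra).
    lra.
Qed.

Lemma ln2_bounds : 693 / 1000 < ln 2 < 6932 / 10000.
Proof.
  pose proof (log_ratio_bounds (1 / 3) ltac:(lra)) as H.
  replace ((1 + 1 / 3) / (1 - 1 / 3)) with 2 in H by field. lra.
Qed.

Lemma ln3_bounds : 10983 / 10000 < ln 3 < 10988 / 10000.
Proof.
  pose proof (log_ratio_bounds (1 / 7) ltac:(lra)) as H.
  replace ((1 + 1 / 7) / (1 - 1 / 7)) with (2 * 2 / 3) in H by field.
  rewrite ln_div, ln_mult in H by lra. pose proof ln2_bounds. lra.
Qed.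

(* The [k]-th [s]-derivative of [y^-s]. *)
Definition dpow (k : nat) (y s : R) : R := (- ln y) ^ k * exp (- (s * ln y)).

Lemma is_derive_dpow k y s : is_derive (dpow k y) s (dpow (S k) y s).
Proof. unfold dpow. auto_derive; [easy|]. simpl. ring. Qed.

Definition diff3 (f : R -> R) (x : R) : R := f x - 3 * f (x + 1) + 3 * f (x + 2) - f (x + 3).

(** Each mean value step lowers the order of the difference by one and enlarges the interval by one.
    The minus sign appears because [diff3] is minus the third forward difference. *)
Lemma diff3_mvt (f f1 f2 f3 : R -> R) (x : R) : 0 < x ->
  (forall y, 0 < y -> is_derive f y (f1 y)) ->
  (forall y, 0 < y -> is_derive f1 y (f2 y)) ->
  (forall y, 0 < y -> is_derive f2 y (f3 y)) ->
  exists xi, x < xi < x + 3 /\ diff3 f x = - f3 xi.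
Proof.
  intros Hx H1 H2 H3.
  assert (S : forall (g g' : R -> R) a y, 0 < y -> 0 <= a ->
    (forall y, 0 < y -> is_derive g y (g' y)) -> is_derive (fun t => g (t + a)) y (g' (y + a))).
  { intros g g' a y Hy Ha Hg.
    evar_last. apply (is_derive_comp g (fun t => t + a)). apply Hg; lra.
    auto_derive; [easy|reflexivity].
    unfold scal; simpl; unfold mult; simpl; ring. }
  destruct (MVT_cor2 (fun t => f t - 2 * f (t + 1) + f (t + 2))
     (fun t => f1 t - 2 * f1 (t + 1) + f1 (t + 2)) x (x + 1)) as (c1 & E1 & B1); [lra| |].
  { intros c Hc. apply is_derive_Reals.
    apply (is_derive_plus (fun t => f t - 2 * f (t + 1))); [apply (is_derive_minus f)|].
    apply H1; lra. apply is_derive_scal. apply S; auto; lra. apply S; auto; lra. }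
  destruct (MVT_cor2 (fun t => f1 t - f1 (t + 1))
     (fun t => f2 t - f2 (t + 1)) c1 (c1 + 1)) as (c2 & E2 & B2); [lra| |].
  { intros c Hc. apply is_derive_Reals. apply (is_derive_minus f1).
    apply H2; lra. apply S; auto; lra. }
  destruct (MVT_cor2 f2 f3 c2 (c2 + 1)) as (c3 & E3 & B3); [lra| |].
  { intros c Hc. apply is_derive_Reals. apply H3; lra. }
  exists c3. split; [lra|]. unfold diff3.
  replace (x + 1 + 1) with (x + 2) in E1 by ring.
  replace (x + 1 + 2) with (x + 3) in E1 by ring.
  replace (c1 + 1 + 1) with (c1 + 2) in E2 by ring. lra.
Qed.

(** Minus the third y-derivative of y^-s is p(s) y^(-s-3) with p(s) = s (s + 1) (s + 2). The kernels
    here and in [diff3_dpow2] are its first two s-derivatives: p' = 3 s^2 + 6 s + 2 and p'' = 6 (s +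
    1). *)
Lemma diff3_dpow1 s x : 0 < x -> exists xi, x < xi < x + 3 /\
  diff3 (fun y => dpow 1 y s) x =
   ((3 * s ^ 2 + 6 * s + 2) - s * (s + 1) * (s + 2) * ln xi) * exp (- (s * ln xi)) / xi ^ 3.
Proof.
  intros Hx.
  destruct (diff3_mvt (fun y => dpow 1 y s)
    (fun y => (-1 + s * ln y) * exp (- (s * ln y)) / y)
    (fun y => ((1 + 2 * s) - (s + s ^ 2) * ln y) * exp (- (s * ln y)) / y ^ 2)
    (fun y => - (((3 * s ^ 2 + 6 * s + 2) - s * (s + 1) * (s + 2) * ln y) * exp (- (s * ln y))
      / y ^ 3)) x Hx)
   as (xi & B & E).
  - intros y Hy. unfold dpow. auto_derive; [easy|]. field. lra.
  - intros y Hy. auto_derive; [repeat split; lra|]. field. lra.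
  - intros y Hy. auto_derive; [repeat split; try lra; nra|]. field. lra.
  - exists xi. split; [easy|]. rewrite E. ring.
Qed.

Lemma diff3_dpow2 s x : 0 < x -> exists xi, x < xi < x + 3 /\
  diff3 (fun y => dpow 2 y s) x =
   (6 * (s + 1) - 2 * (3 * s ^ 2 + 6 * s + 2) * ln xi + s * (s + 1) * (s + 2) * ln xi ^ 2)
     * exp (- (s * ln xi)) / xi ^ 3.
Proof.
  intros Hx.
  destruct (diff3_mvt (fun y => dpow 2 y s)
    (fun y => (2 * ln y - s * ln y ^ 2) * exp (- (s * ln y)) / y)
    (fun y => (2 - (4 * s + 2) * ln y + s * (s + 1) * ln y ^ 2) * exp (- (s * ln y)) / y ^ 2)
    (fun y => - ((6 * (s + 1) - 2 * (3 * s ^ 2 + 6 * s + 2) * ln y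
      + s * (s + 1) * (s + 2) * ln y ^ 2) * exp (- (s * ln y)) / y ^ 3)) x Hx)
   as (xi & B & E).
  - intros y Hy. unfold dpow. auto_derive; [easy|]. field. lra.
  - intros y Hy. auto_derive; [repeat split; lra|]. field. lra.
  - intros y Hy. auto_derive; [repeat split; try lra; nra|]. field. lra.
  - exists xi. split; [easy|]. rewrite E. ring.
Qed.

Lemma ln_ge_ln2 y : 2 <= y -> 69 / 100 <= ln y.
Proof. intros. pose proof ln2_bounds. pose proof (ln_le 2 y). lra. Qed.

Lemma diff3_dpow1_bound s x : 0 <= s <= 1 -> 2 <= x ->
  Rabs (diff3 (fun y => dpow 1 y s) x) <= 4 / x ^ 3.
Proof.
  intros Hs Hx. destruct (diff3_dpow1 s x ltac:(lra)) as (xi & B & ->).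
  pose proof (ln_ge_ln2 xi ltac:(lra)) as HL.
  assert (0 <= s * ln xi) by nra.
  rewrite exp_Ropp.
  assert (H0 := exp_pos (s * ln xi)). assert (0 < xi ^ 3) by (apply pow_lt; lra).
  unfold Rdiv. rewrite !Rabs_mult, !Rabs_inv, (Rabs_pos_eq (exp _)), (Rabs_pos_eq (xi ^ 3)) by lra.
  apply Rmult_le_compat.
  - apply Rmult_le_pos; [apply Rabs_pos|]. apply Rlt_le, Rinv_0_lt_compat; lra.
  - apply Rlt_le, Rinv_0_lt_compat; lra.
  - apply Rle_div_l; [lra|]. eapply Rle_trans; [apply first_kernel_bound; lra|].
    apply Rmult_le_compat_l; [lra|]. eapply Rle_trans; [|apply exp_taylor3; lra].
    pose proof (pow_le (s * ln xi) 3). lra.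
  - apply Rinv_le_contravar; [apply pow_lt; lra|]. apply pow_incr; lra.
Qed.

(** The two Taylor polynomials lie below exp L = y and exp (s L) = y^s. At s = 0 the kernel is 6 - 4
    L, which no multiple of y^s bounds; hence one power of y is spent, and the decay is 1 / y^2
    instead of 1 / y^3. *)
Lemma second_kernel_scaled c s L y : 0 < y -> L = ln y -> 69/100 <= L -> 0 <= s ->
  c <= 6 / 10 * (1 + L + L ^ 2 / 2 + L ^ 3 / 6) * (1 + s * L + (s * L) ^ 2 / 2 + (s * L) ^ 3 / 6) ->
  c * exp (- (s * L)) / y ^ 3 <= 6 / 10 / y ^ 2.
Proof.
  intros Hy HL HL' Hs H. assert (0 <= s * L) by nra.
  assert (c <= 6 / 10 * y * exp (s * L)).
  { eapply Rle_trans; [exact H|]. rewrite !Rmult_assoc. apply Rmult_le_compat_l; [lra|].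
    pose proof (exp_taylor3 L ltac:(lra)) as T.
    replace (exp L) with y in T by (rewrite HL, exp_ln; lra).
    assert (0 <= (s * L)^3) by (apply pow_le; lra). assert (0 <= L^3) by (apply pow_le; lra).
    apply Rmult_le_compat; try nra. now apply exp_taylor3. }
  rewrite exp_Ropp. pose proof (exp_pos (s * L)).
  replace (c * / exp (s * L) / y ^ 3) with (c / exp (s * L) / y ^ 3) by (unfold Rdiv; ring).
  apply Rle_div_l; [apply pow_lt; lra|]. apply Rle_div_l; [lra|].
  replace (6 / 10 / y ^ 2 * y ^ 3 * exp (s * L)) with (6 / 10 * y * exp (s * L)) by (field; lra).
  easy.
Qed.

Lemma inv_sqr_le c x y : 0 <= c -> 0 < x <= y -> c / y ^ 2 <= c / x ^ 2.
Proof.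
  intros Hc H. apply Rmult_le_compat_l; [easy|]. apply Rinv_le_contravar; [apply pow_lt; lra|].
  apply pow_incr; lra.
Qed.

Lemma diff3_dpow2_lower s x : 0 <= s <= 1 -> 2 <= x ->
  - diff3 (fun y => dpow 2 y s) x <= 6 / 10 / x ^ 2.
Proof.
  intros Hs Hx. destruct (diff3_dpow2 s x ltac:(lra)) as (xi & B & ->).
  pose proof (ln_ge_ln2 xi ltac:(lra)) as HL.
  eapply Rle_trans; [|apply (inv_sqr_le _ x xi); lra].
  pose proof (second_kernel_scaled _ s _ xi ltac:(lra) eq_refl HL ltac:(lra)
    (second_kernel_lower s _ Hs HL)).
  eapply Rle_trans; [|eassumption].
  apply Req_le; field; lra.
Qed.

Lemma diff3_dpow2_upper s x : 0 <= s <= 1 -> 3 <= x ->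
  diff3 (fun y => dpow 2 y s) x <= 6 / 10 / x ^ 2.
Proof.
  intros Hs Hx. destruct (diff3_dpow2 s x ltac:(lra)) as (xi & B & ->).
  assert (HL : 1098 / 1000 <= ln xi).
  { pose proof ln3_bounds. pose proof (ln_le 3 xi). lra. }
  eapply Rle_trans; [|apply (inv_sqr_le _ x xi); lra].
  pose proof (second_kernel_scaled _ s _ xi ltac:(lra) eq_refl ltac:(lra) ltac:(lra)
    (second_kernel_upper s _ Hs HL)).
  eassumption.
Qed.

(** * Concavity and monotonicity of eta *)

Lemma exp_le x y : x <= y -> exp x <= exp y.
Proof. intros [H| ->]; [left; now apply exp_increasing|apply Rle_refl]. Qed.

Definition eta_term (s : R) (n : nat) : R := (-1) ^ n * dpow 0 (INR (n + 1)) s.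

Lemma eta_term_eq s n : (-1) ^ n / Rpower (INR (n + 1)) s = eta_term s n.
Proof. unfold eta_term, dpow, Rpower, Rdiv. simpl. now rewrite exp_Ropp, Rmult_1_l. Qed.

Lemma INR_S_pos n : 0 < INR (n + 1).
Proof. apply lt_0_INR. lia. Qed.

Lemma dpow0_decr s x y : 0 <= s -> 0 < x <= y -> dpow 0 y s <= dpow 0 x s.
Proof.
  intros Hs H. unfold dpow. simpl. rewrite !Rmult_1_l.
  pose proof (ln_le x y). apply exp_le. nra.
Qed.

Lemma is_lim_seq_dpow0 s : 0 < s -> is_lim_seq (fun n => dpow 0 (INR (n + 1)) s) 0.
Proof.
  intros Hs. unfold dpow. simpl.
  apply (is_lim_seq_ext (fun n => exp (- (s * ln (INR (n + 1)))))); [intros; ring|].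
  apply (is_lim_comp_seq exp _ m_infty 0).
  - apply is_lim_exp_m.
  - exists 0%nat. now intros.
  - apply (is_lim_seq_opp _ p_infty).
    replace p_infty with (Rbar_mult s p_infty).
    apply is_lim_seq_scal_l.
    + apply (is_lim_comp_seq ln _ p_infty p_infty).
      * apply is_lim_ln_p.
      * exists 0%nat. now intros.
      * apply (is_lim_seq_incr_n INR 1), is_lim_seq_INR.
    + simpl. destruct (Rle_dec 0 s); [|lra]. destruct (Rle_lt_or_eq_dec 0 s _); [easy|lra].
Qed.

Lemma ex_series_eta s : 0 < s -> ex_series (eta_term s).
Proof.
  intros Hs.
  destruct (alternated_series (fun n => dpow 0 (INR (n + 1)) s)) as [l Hl].
  - intros n. apply dpow0_decr; [lra|]. split; [apply INR_S_pos|]. apply le_INR. lia.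
  - apply is_lim_seq_Reals. now apply is_lim_seq_dpow0.
  - exists l. apply is_series_Reals. exact Hl.
Qed.

Lemma is_series_eta s : 0 < s -> is_series (eta_term s) (dirichlet_eta s).
Proof.
  intros Hs. unfold dirichlet_eta. rewrite (Series_ext _ (eta_term s)) by (intros;
    apply eta_term_eq).
  now apply Series_correct, ex_series_eta.
Qed.

(* The [k]-th [s]-derivative of the [N]-th partial sum of the series for [eta s] obtained by
   applying Euler's transformation three times. *)
Fixpoint euler3 (k N : nat) (s : R) : R :=
  match N with
  | O => / 8 * (7 * dpow k 1 s - 4 * dpow k 2 s + dpow k 3 s)
  | S j => euler3 k j s + (-1) ^ j / 8 * diff3 (fun y => dpow k y s) (INR (j + 1))
  end.

Lemma sum_n_S (a : nat -> R) n : sum_n a (S n) = sum_n a n + a (S n).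
Proof. exact (sum_Sn a n). Qed.

(** Three averagings of consecutive partial sums give the weights 1, 3, 3, 1 over 8, and the
    increments of this mean are signed third differences. Convergence of [euler3] to eta is
    therefore immediate, with no rearrangement of the series. *)
Lemma euler3_partial_sums s N :
  euler3 0 (S N) s = (sum_n (eta_term s) N + 3 * sum_n (eta_term s) (S N)
    + 3 * sum_n (eta_term s) (S (S N)) + sum_n (eta_term s) (S (S (S N)))) / 8.
Proof.
  induction N as [|N IH].
  - rewrite !sum_n_S, sum_O. unfold eta_term. simpl. unfold diff3.
    replace (1 + 1 + 1 + 1) with 4 by ring. replace (1 + 1 + 1) with 3 by ring.
    replace (1 + 3) with 4 by ring. replace (1 + 2) with 3 by ring.
    replace (1 + 1) with 2 by ring. field.
  - change (euler3 0 (S (S N)) s) with (euler3 0 (S N) s + (-1) ^ (S N) / 8 * diff3 (fun y =>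
      dpow 0 y s) (INR (S N + 1))).
    rewrite IH. rewrite (sum_n_S _ (S (S (S N)))), (sum_n_S _ (S (S N))), (sum_n_S _ (S N)),
      (sum_n_S _ N).
    unfold eta_term, diff3.
    replace (INR (S N + 1) + 1) with (INR (S (S N) + 1)) by (rewrite !plus_INR, !S_INR; simpl;
      ring).
    replace (INR (S N + 1) + 2) with (INR (S (S (S N)) + 1)) by (rewrite !plus_INR, !S_INR;
      simpl; ring).
    replace (INR (S N + 1) + 3) with (INR (S (S (S (S N))) + 1)) by (rewrite !plus_INR, !S_INR;
      simpl; ring).
    cbn [pow]. field.
Qed.

Lemma is_lim_seq_euler3 s : 0 < s -> is_lim_seq (fun N => euler3 0 (S N) s) (dirichlet_eta s).
Proof.
  intros Hs. assert (H : is_lim_seq (sum_n (eta_term s)) (dirichlet_eta s))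
    by now apply is_series_eta.
  eapply is_lim_seq_ext; [intros; symmetry; apply euler3_partial_sums|].
  set (u := sum_n (eta_term s)) in *.
  assert (H1 : is_lim_seq (fun n => u (S n)) (dirichlet_eta s)) by (apply -> is_lim_seq_incr_1;
    easy).
  assert (H2 : is_lim_seq (fun n => u (S (S n))) (dirichlet_eta s))
    by (apply -> (is_lim_seq_incr_1 (fun n => u (S n))); easy).
  assert (H3 : is_lim_seq (fun n => u (S (S (S n)))) (dirichlet_eta s))
    by (apply -> (is_lim_seq_incr_1 (fun n => u (S (S n)))); easy).
  replace (dirichlet_eta s) with ((dirichlet_eta s + 3 * dirichlet_eta s + 3 * dirichlet_eta s
    + dirichlet_eta s) * / 8) by field.
  apply (is_lim_seq_scal_r _ (/ 8) (Finite _)).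
  repeat apply is_lim_seq_plus'; auto.
  apply (is_lim_seq_scal_l _ 3 (Finite _)); auto.
  apply (is_lim_seq_scal_l _ 3 (Finite _)); auto.
Qed.

Lemma is_derive_diff3 k x s :
  is_derive (fun s => diff3 (fun y => dpow k y s) x) s (diff3 (fun y => dpow (S k) y s) x).
Proof.
  unfold diff3.
  apply (is_derive_minus (fun s => _ - _ + _) (dpow k (x + 3))); [|apply is_derive_dpow].
  apply (is_derive_plus (fun s => _ - _)).
  apply (is_derive_minus (dpow k x)); [apply is_derive_dpow|].
  all: apply is_derive_scal, is_derive_dpow.
Qed.

Lemma is_derive_euler3 k N s : is_derive (euler3 k N) s (euler3 (S k) N s).
Proof.
  induction N as [|N IH]; simpl.
  - apply is_derive_scal.
    apply (is_derive_plus (fun s => _ - _)); [|apply is_derive_dpow].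
    apply (is_derive_minus (fun s => 7 * _)); apply is_derive_scal, is_derive_dpow.
  - apply (is_derive_plus (euler3 k N)); [easy|]. apply is_derive_scal, is_derive_diff3.
Qed.

(** * Signs of the s-derivatives of the Euler sums *)

Lemma dpow_1 k s : dpow (S k) 1 s = 0.
Proof. unfold dpow. rewrite ln_1. simpl. ring. Qed.

(* Convexity of [L |-> exp (- s L)] between [ln 2] and [ln 4]; 0.584 is just below
   [ln 3 / ln 2 - 1]. *)
Lemma dpow0_3_chord s : 0 <= s ->
  exp (- (s * ln 3)) <= 416 / 1000 * exp (- (s * ln 2)) + 584 / 1000 * exp (- (s * ln 2)) ^ 2.
Proof.
  intros Hs. pose proof ln2_bounds. pose proof ln3_bounds.
  assert (E1 : exp (- (s * ln 2)) = exp (- (s * ln 3)) * exp (s * (ln 3 - ln 2))).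
  { rewrite <- exp_plus. f_equal. ring. }
  assert (E2 : exp (- (s * ln 2)) ^ 2 = exp (- (s * ln 3)) * exp (- (s * (2 * ln 2 - ln 3)))).
  { simpl. rewrite Rmult_1_r, <- !exp_plus. f_equal. ring. }
  rewrite E1 at 1. rewrite E2.
  pose proof (exp_ineq1_le (s * (ln 3 - ln 2))).
  pose proof (exp_ineq1_le (- (s * (2 * ln 2 - ln 3)))).
  pose proof (exp_pos (- (s * ln 3))).
  assert (1 <= 416 / 1000 * exp (s * (ln 3 - ln 2)) + 584 / 1000 * exp (- (s * (2 * ln 2 - ln
    3)))); nra.
Qed.

Lemma exp_2_range s : 0 <= s <= 1 -> 1 / 2 <= exp (- (s * ln 2)) <= 1.
Proof.
  intros Hs. pose proof ln2_bounds. split.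
  - rewrite exp_Ropp. replace (1 / 2) with (/ exp (ln 2)) by (rewrite exp_ln; lra).
    apply Rinv_le_contravar; [apply exp_pos|]. apply exp_le. nra.
  - rewrite <- exp_0. apply exp_le. nra.
Qed.

Lemma ln_4 : ln 4 = 2 * ln 2.
Proof. replace 4 with (2 * 2) by ring. rewrite ln_mult by lra. ring. Qed.

Lemma euler3_1_eq k s : euler3 (S k) 1 s = (- 7 * dpow (S k) 2 s + 4 * dpow (S k) 3 s - dpow (S
  k) 4 s) / 8.
Proof.
  simpl. unfold diff3. rewrite dpow_1.
  replace (1 + 1) with 2 by ring. replace (1 + 2) with 3 by ring. replace (1 + 3) with 4 by ring.
  field.
Qed.

Lemma exp_4 s : exp (- (s * ln 4)) = exp (- (s * ln 2)) ^ 2.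
Proof. rewrite ln_4. simpl. rewrite Rmult_1_r, <- exp_plus. f_equal. ring. Qed.

(** With p = 2^-s in [1/2, 1], 4^-s = p^2, and 3^-s bounded by the chord, the lower estimate is a
    concave quadratic in p, smallest at p = 1/2, where it is about 1.216. *)
Lemma euler3_1_1_bounds s : 0 <= s <= 1 -> 12 / 10 <= 8 * euler3 1 1 s <= 7.
Proof.
  intros Hs. rewrite euler3_1_eq. unfold dpow. rewrite exp_4, ln_4.
  pose proof (dpow0_3_chord s ltac:(lra)). pose proof (exp_2_range s Hs).
  pose proof ln2_bounds. pose proof ln3_bounds.
  set (p := exp (- (s * ln 2))) in *. set (r := exp (- (s * ln 3))) in *.
  assert (0 < r) by apply exp_pos. clearbody p r.
  assert (12 / 10 <= 7 * (693 / 1000) * p - 4 * (10988 / 10000) * r + 2 * (693 / 1000) * p ^ 2)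
    by nra.
  simpl. assert (0 <= (ln 2 - 693 / 1000) * p) by nra.
  assert (0 <= (ln 2 - 693 / 1000) * p ^ 2) by nra.
  assert (0 <= (10988 / 10000 - ln 3) * r) by nra. split; [lra|nra].
Qed.

(** The same reduction gives a convex quadratic in p = 2^-s with end values of about - 0.4515 at p =
    1/2 and - 0.4533 at p = 1, so it leaves hardly any room beyond 0.45. *)
Lemma euler3_2_1_upper s : 0 <= s <= 1 -> 8 * euler3 2 1 s <= - (45 / 100).
Proof.
  intros Hs. rewrite euler3_1_eq. unfold dpow. rewrite exp_4, ln_4.
  pose proof (dpow0_3_chord s ltac:(lra)). pose proof (exp_2_range s Hs).
  pose proof ln2_bounds. pose proof ln3_bounds.
  set (p := exp (- (s * ln 2))) in *. set (r := exp (- (s * ln 3))) in *.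
  assert (0 < r) by apply exp_pos. clearbody p r.
  assert (Ha : (693 / 1000) ^ 2 <= ln 2 ^ 2) by (apply pow_incr; lra).
  assert (Hb : ln 3 ^ 2 <= (10988 / 10000) ^ 2) by (apply pow_incr; lra).
  assert (-7 * (693 / 1000) ^ 2 * p + 4 * (10988 / 10000) ^ 2 * r - 4 * (693 / 1000) ^ 2 * p ^
    2 <= - (45 / 100)) by nra.
  assert (0 <= (ln 2 ^ 2 - (693 / 1000) ^ 2) * p) by (apply Rmult_le_pos; lra).
  assert (0 <= (ln 2 ^ 2 - (693 / 1000) ^ 2) * p ^ 2) by (apply Rmult_le_pos;
    [lra|apply pow2_ge_0]).
  assert (0 <= ((10988 / 10000) ^ 2 - ln 3 ^ 2) * r) by (apply Rmult_le_pos; lra).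
  replace ((- (2 * ln 2)) ^ 2) with (4 * ln 2 ^ 2) by ring.
  replace ((- ln 2) ^ 2) with (ln 2 ^ 2) by ring. replace ((- ln 3) ^ 2) with (ln 3 ^ 2) by ring.
  lra.
Qed.

Lemma pow_m1_cases n : (-1) ^ n = 1 \/ (-1) ^ n = -1.
Proof. induction n as [|n [E|E]]; simpl; rewrite ?E; lra. Qed.

(* The margins are telescoping majorants of the remaining terms: [sum 4 / n^3] here and
   [sum 0.6 / n^2] in the next lemma. *)
Lemma euler3_1_bounds s N : 0 <= s <= 1 ->
  2 / 10 + 2 / (INR (N + 1) * (INR (N + 1) + 1)) <= 8 * euler3 1 (S N) s
    <= 8 - 2 / (INR (N + 1) * (INR (N + 1) + 1)).
Proof.
  intros Hs. induction N as [|N IH].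
  - pose proof (euler3_1_1_bounds s Hs). simpl (INR _). lra.
  - change (euler3 1 (S (S N)) s) with
      (euler3 1 (S N) s + (-1) ^ (S N) / 8 * diff3 (fun y => dpow 1 y s) (INR (S N + 1))).
    replace (INR (S N + 1)) with (INR (N + 1) + 1) by (rewrite !plus_INR, (S_INR N); simpl; ring).
    assert (1 <= INR (N + 1)) by (rewrite plus_INR; pose proof (pos_INR N); simpl; lra).
    set (x := INR (N + 1)) in *.
    pose proof (diff3_dpow1_bound s (x + 1) Hs ltac:(lra)) as B.
    assert (4 / (x + 1) ^ 3 <= 2 / (x * (x + 1)) - 2 / ((x + 1) * (x + 1 + 1))).
    { replace (2 / (x * (x + 1)) - 2 / ((x + 1) * (x + 1 + 1))) with (4 / (x * (x + 1) * (x +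
        2))) by (field; lra).
      apply Rmult_le_compat_l; [lra|]. apply Rinv_le_contravar; nra. }
    apply Rabs_le_between in B.
    destruct (pow_m1_cases (S N)) as [E|E]; rewrite E; lra.
Qed.

Lemma euler3_2_upper s N : 0 <= s <= 1 ->
  8 * euler3 2 (S N) s <= - (5 / 100) - 6 / 10 / (INR (N + 1) + / 2).
Proof.
  intros Hs. induction N as [|N IH].
  - pose proof (euler3_2_1_upper s Hs). simpl (INR _). lra.
  - change (euler3 2 (S (S N)) s) with
      (euler3 2 (S N) s + (-1) ^ (S N) / 8 * diff3 (fun y => dpow 2 y s) (INR (S N + 1))).
    assert (HN : INR (S N + 1) = INR N + 2) by (rewrite plus_INR, (S_INR N); simpl; ring).
    assert (HN' : INR (N + 1) = INR N + 1) by (rewrite plus_INR; simpl; ring).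
    rewrite HN in *. rewrite HN' in *. pose proof (pos_INR N).
    (* (N + 3/2) (N + 5/2) = (N + 2)^2 - 1/4. The half-integer shift makes the whole tail cost 0.6 /
       1.5 = 0.4; the cruder majorant 1 / (n (n - 1)) would cost 0.6 and exceed the available
       0.45. *)
    assert (6 / 10 / (INR N + 2) ^ 2 <= 6 / 10 / (INR N + 1 + / 2) - 6 / 10 / (INR N + 2 + / 2)).
    { replace (6 / 10 / (INR N + 1 + / 2) - 6 / 10 / (INR N + 2 + / 2)) with (6 / 10 / ((INR N
        + 1 + / 2) * (INR N + 2 + / 2))) by (field; lra).
      apply Rmult_le_compat_l; [lra|]. apply Rinv_le_contravar; nra. }
    destruct (pow_m1_cases (S N)) as [E|E]; rewrite E.
    (* A plus sign first occurs at N = 1, that is at base point 3, exactly where the upper kernel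
       bound becomes available. *)
    + assert (1 <= INR N).
      { destruct N; [simpl in E; lra|]. rewrite S_INR. pose proof (pos_INR N). lra. }
      pose proof (diff3_dpow2_upper s (INR N + 2) Hs ltac:(lra)). lra.
    + pose proof (diff3_dpow2_lower s (INR N + 2) Hs ltac:(lra)). lra.
Qed.

Lemma euler3_2_nonpos N s : 0 <= s <= 1 -> euler3 2 (S N) s <= 0.
Proof.
  intros Hs. pose proof (euler3_2_upper s N Hs). pose proof (pos_INR (N + 1)).
  assert (0 < 6 / 10 / (INR (N + 1) + / 2)) by (apply Rdiv_lt_0_compat; lra).
  lra.
Qed.

(** * Passage from the Euler sums to eta *)

Lemma concave_of_derive2 (f f1 f2 : R -> R) (a b : R) :
  (forall x, a <= x <= b -> is_derive f x (f1 x)) ->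
  (forall x, a <= x <= b -> is_derive f1 x (f2 x)) ->
  (forall x, a <= x <= b -> f2 x <= 0) ->
  forall x y t, a <= x -> x < y -> y <= b -> 0 < t < 1 ->
  t * f x + (1 - t) * f y <= f (t * x + (1 - t) * y).
Proof.
  intros H1 H2 H3 x y t Hx Hxy Hy Ht. set (z := t * x + (1 - t) * y).
  assert (x < z < y) by (unfold z; nra).
  destruct (MVT_cor2 f f1 x z) as (c & Ec & Bc); [lra|intros; apply is_derive_Reals, H1; lra|].
  destruct (MVT_cor2 f f1 z y) as (d & Ed & Bd); [lra|intros; apply is_derive_Reals, H1; lra|].
  destruct (MVT_cor2 f1 f2 c d) as (e & Ee & Be); [lra|intros; apply is_derive_Reals, H2; lra|].
  pose proof (H3 e ltac:(lra)).
  assert (f1 d <= f1 c) by nra.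
  replace (z - x) with ((1 - t) * (y - x)) in Ec by (unfold z; ring).
  replace (y - z) with (t * (y - x)) in Ed by (unfold z; ring).
  assert (0 <= t * (1 - t) * (y - x) * (f1 c - f1 d)).
  { repeat apply Rmult_le_pos; lra. }
  nra.
Qed.

Lemma eta_concave x y t : 0 < x -> x < y -> y <= 1 -> 0 < t < 1 ->
  t * dirichlet_eta x + (1 - t) * dirichlet_eta y <= dirichlet_eta (t * x + (1 - t) * y).
Proof.
  intros Hx Hxy Hy Ht.
  apply (is_lim_seq_le (fun N => t * euler3 0 (S N) x + (1 - t) * euler3 0 (S N) y)
    (fun N => euler3 0 (S N) (t * x + (1 - t) * y)) (Finite _) (Finite _)).
  - intros N. apply (concave_of_derive2 (euler3 0 (S N)) (euler3 1 (S N)) (euler3 2 (S N)) 0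
      1); try lra;
      try (intros; apply is_derive_euler3).
    exact (euler3_2_nonpos N).
  - apply is_lim_seq_plus'; apply (is_lim_seq_scal_l _ _ (Finite _)), is_lim_seq_euler3; lra.
  - apply is_lim_seq_euler3. nra.
Qed.

Lemma euler3_increment x y N : 0 <= x -> x < y -> y <= 1 ->
  1 / 40 * (y - x) <= euler3 0 (S N) y - euler3 0 (S N) x <= y - x.
Proof.
  intros Hx Hxy Hy.
  destruct (MVT_cor2 (euler3 0 (S N)) (euler3 1 (S N)) x y) as (c & -> & Bc);
    [lra|intros; apply is_derive_Reals, is_derive_euler3|].
  pose proof (euler3_1_bounds c N ltac:(lra)). pose proof (INR_S_pos N).
  assert (0 < 2 / (INR (N + 1) * (INR (N + 1) + 1))) by (apply Rdiv_lt_0_compat; nra).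
  split; [|rewrite <- (Rmult_1_l (y - x)) at 2]; apply Rmult_le_compat_r; lra.
Qed.

Lemma eta_increment x y : 0 < x -> x < y -> y <= 1 ->
  1 / 40 * (y - x) <= dirichlet_eta y - dirichlet_eta x <= y - x.
Proof.
  intros Hx Hxy Hy.
  assert (L : is_lim_seq (fun N => euler3 0 (S N) y - euler3 0 (S N) x) (dirichlet_eta y -
    dirichlet_eta x))
    by (apply is_lim_seq_minus'; apply is_lim_seq_euler3; lra).
  split.
  - apply (is_lim_seq_le (fun _ => 1 / 40 * (y - x)) _ (Finite _) (Finite _)) with (3 := L);
      [intros N; apply euler3_increment; lra|apply is_lim_seq_const].
  - apply (is_lim_seq_le _ (fun _ => y - x) (Finite _) (Finite _)) with (2 := L);
      [intros N; apply euler3_increment; lra|apply is_lim_seq_const].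
Qed.

Lemma eta_increasing x y : 0 < x -> x < y -> y <= 1 -> dirichlet_eta x < dirichlet_eta y.
Proof. intros Hx Hxy Hy. pose proof (eta_increment x y Hx Hxy Hy). lra. Qed.

(** At s = 0 third differences of a constant vanish and only (7 - 4 + 1) / 8 remains. This is the
    source of the boundary value eta 0+ = 1/2. *)
Lemma euler3_0_0 N : euler3 0 N 0 = / 2.
Proof.
  assert (H : forall y, dpow 0 y 0 = 1).
  { intros y. unfold dpow. rewrite Rmult_0_l, Ropp_0, exp_0. simpl. ring. }
  induction N as [|N IH]; simpl; unfold diff3; rewrite ?IH, !H; field.
Qed.

Lemma eta_near_0 s : 0 < s <= 1 -> / 2 < dirichlet_eta s <= / 2 + s.
Proof.
  intros Hs. pose proof (is_lim_seq_euler3 s ltac:(lra)) as L.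
  assert (B : forall N, / 2 + 1 / 40 * s <= euler3 0 (S N) s <= / 2 + s).
  { intros N. pose proof (euler3_increment 0 s N ltac:(lra) ltac:(lra) ltac:(lra)).
    rewrite (euler3_0_0 (S N)) in *. lra. }
  split.
  - apply Rlt_le_trans with (/ 2 + 1 / 40 * s); [lra|].
    apply (is_lim_seq_le (fun _ => / 2 + 1 / 40 * s) _ (Finite _) (Finite _)) with (3 := L);
      [apply B|apply is_lim_seq_const].
  - apply (is_lim_seq_le _ (fun _ => / 2 + s) (Finite _) (Finite _)) with (2 := L);
      [apply B|apply is_lim_seq_const].
Qed.

(** * The value of eta at 1 *)

Lemma le_of_derive_le (f g f' g' : R -> R) (a b : R) : a <= b -> f a <= g a ->
  (forall x, a <= x <= b -> is_derive f x (f' x)) ->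
  (forall x, a <= x <= b -> is_derive g x (g' x)) ->
  (forall x, a <= x <= b -> f' x <= g' x) -> f b <= g b.
Proof.
  intros [Hab| <-] H0 Hf Hg H; [|easy].
  destruct (MVT_cor2 (fun x => g x - f x) (fun x => g' x - f' x) a b Hab) as (c & E & B).
  - intros c Hc. apply is_derive_Reals. apply (is_derive_minus g); auto.
  - pose proof (H c ltac:(lra)). nra.
Qed.

Lemma geometric_alt x n : 0 <= x ->
  sum_n (fun k => (-1) ^ k * x ^ k) n - / (1 + x) = (-1) ^ n * x ^ (S n) / (1 + x).
Proof.
  intros Hx. induction n as [|n IH].
  - rewrite sum_O. simpl. field. lra.
  - rewrite sum_n_S. simpl in *.
    replace (sum_n _ n) with (/ (1 + x) + (-1) ^ n * (x * x ^ n) / (1 + x)) by lra. field. lra.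
Qed.

(** The error of the Taylor sum of ln (1 + x) has derivative (-1)^n x^(n+1) / (1 + x), at most
    x^(n+1) in absolute value; comparing with x^(n+2) / (n + 2) from 0 to 1 gives the bound. *)
Lemma ln_taylor_error n :
  Rabs (sum_n (fun k => (-1) ^ k / INR (k + 1)) n - ln 2) <= / INR (n + 2).
Proof.
  set (f := fun x => sum_n (fun k => (-1) ^ k * (x ^ (k + 1) / INR (k + 1))) n - ln (1 + x)).
  assert (Hf : forall x, 0 <= x <= 1 -> is_derive f x ((-1) ^ n * x ^ (S n) / (1 + x))).
  { intros x Hx. rewrite <- geometric_alt by lra. unfold f.
    apply (is_derive_minus (fun x => sum_n _ n) (fun x => ln (1 + x))).
    - apply (is_derive_sum_n (fun k x => (-1) ^ k * (x ^ (k + 1) / INR (k + 1)))).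
      intros k _. apply is_derive_scal. auto_derive; [easy|].
      rewrite Nat.add_1_r. simpl Nat.pred. field. apply not_0_INR. lia.
    - auto_derive; [lra|]. field. lra. }
  assert (Hg : forall c x, 0 <= x <= 1 -> is_derive (fun x => c * (x ^ (n + 2) / INR (n + 2)))
    x (c * x ^ (S n))).
  { intros c x Hx. apply is_derive_scal. auto_derive; [easy|].
    replace (Init.Nat.pred (n + 2)) with (S n) by lia. field. apply not_0_INR. lia. }
  assert (f0 : f 0 = 0).
  { unfold f. rewrite Rplus_0_r, ln_1. rewrite (sum_n_ext _ (fun _ => 0)).
    - rewrite sum_n_const. ring.
    - intros k. rewrite pow_i by lia. unfold Rdiv. rewrite Rmult_0_l. apply Rmult_0_r. }
  assert (g0 : forall c, c * (0 ^ (n + 2) / INR (n + 2)) = 0).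
  { intros c. rewrite pow_i by lia. unfold Rdiv. ring. }
  assert (f1 : f 1 = sum_n (fun k => (-1) ^ k / INR (k + 1)) n - ln 2).
  { unfold f. replace (1 + 1) with 2 by ring. f_equal. apply sum_n_ext. intros k. rewrite pow1.
    unfold Rdiv. now rewrite Rmult_1_l. }
  assert (g1 : forall c, c * (1 ^ (n + 2) / INR (n + 2)) = c * / INR (n + 2)).
  { intros c. rewrite pow1. unfold Rdiv. ring. }
  assert (B : forall x, 0 <= x <= 1 -> Rabs ((-1) ^ n * x ^ (S n) / (1 + x)) <= x ^ (S n)).
  { intros x Hx. assert (0 <= x ^ S n) by (apply pow_le; lra).
    unfold Rdiv. rewrite !Rabs_mult, pow_1_abs, Rmult_1_l, Rabs_inv, !Rabs_pos_eq by lra.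
    rewrite <- (Rmult_1_r (x ^ S n)) at 2. apply Rmult_le_compat_l; [easy|].
    rewrite <- Rinv_1. apply Rinv_le_contravar; lra. }
  rewrite <- f1. apply Rabs_le. split.
  - replace (- / INR (n + 2)) with (-1 * / INR (n + 2)) by ring. rewrite <- g1.
    apply (le_of_derive_le (fun x => -1 * (x ^ (n + 2) / INR (n + 2))) f (fun x => -1 * x ^ (S
      n)) (fun x => (-1) ^ n * x ^ (S n) / (1 + x)) 0 1); auto; [lra|rewrite f0, g0; lra|].
    intros x Hx. specialize (B x Hx). apply Rabs_le_between in B. lra.
  - replace (/ INR (n + 2)) with (1 * / INR (n + 2)) by ring. rewrite <- g1.
    apply (le_of_derive_le f (fun x => 1 * (x ^ (n + 2) / INR (n + 2))) (fun x => (-1) ^ n * x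
      ^ (S n) / (1 + x)) (fun x => 1 * x ^ (S n)) 0 1); auto; [lra|rewrite f0, g0; lra|].
    intros x Hx. specialize (B x Hx). apply Rabs_le_between in B. lra.
Qed.

Lemma eta_1 : dirichlet_eta 1 = ln 2.
Proof.
  unfold dirichlet_eta. apply is_series_unique.
  apply (is_series_ext (fun n => (-1) ^ n / INR (n + 1))).
  { intros n. rewrite Rpower_1; [easy|apply INR_S_pos]. }
  set (u := sum_n (fun n => (-1) ^ n / INR (n + 1))).
  assert (H : is_lim_seq (fun n => u n - ln 2) 0).
  2: { change (is_lim_seq u (ln 2)). apply (is_lim_seq_ext (fun n => (u n - ln 2) + ln 2));
    [intros; ring|].
       pose proof (is_lim_seq_plus' _ _ _ _ H (is_lim_seq_const (ln 2))) as H'.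
       now rewrite Rplus_0_l in H'. }
  apply is_lim_seq_abs_0.
  apply (is_lim_seq_le_le (fun _ => 0) _ (fun n => / INR (n + 2))).
  - intros n. split; [apply Rabs_pos|apply ln_taylor_error].
  - apply is_lim_seq_const.
  - apply (is_lim_seq_inv _ p_infty); [|easy].
    apply (is_lim_seq_incr_n INR 2), is_lim_seq_INR.
Qed.

(** * Real-analytic functions *)

Lemma is_series_lim_seq (a : nat -> R) (l : R) : is_lim_seq (sum_n a) l -> is_series a l.
Proof. easy. Qed.

Definition real_analytic_at (f : R -> R) (x : R) : Prop :=
  exists (a : nat -> R) (d : R), 0 < d /\
    forall y, Rabs (y - x) < d -> is_pseries a (y - x) (f y).

(** Convergence at a point between |h| and d forces the terms there to tend to 0, so that point is
    not outside the disk of convergence. Cauchy products need this form of the hypothesis. *)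
Lemma CV_radius_of_is_pseries (a : nat -> R) (d h : R) (f : R -> R) :
  (forall t, Rabs t < d -> is_pseries a t (f t)) -> Rabs h < d -> Rbar_lt (Rabs h) (CV_radius a).
Proof.
  intros H Hh. pose proof (Rabs_pos h).
  set (r := (Rabs h + d) / 2). assert (Hr : Rabs r = r) by (apply Rabs_pos_eq; unfold r; lra).
  apply Rbar_lt_le_trans with (Finite r); [simpl; unfold r; lra|].
  apply Rbar_not_lt_le. intros C. rewrite <- Hr in C. apply (CV_disk_outside a r C).
  assert (S : ex_series (fun n => a n * r ^ n)).
  { exists (f r). apply is_pseries_R, H. rewrite Hr. unfold r. lra. }
  now apply ex_series_lim_0.
Qed.

Lemma real_analytic_ext_loc f g x e : 0 < e -> (forall y, Rabs (y - x) < e -> f y = g y) ->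
  real_analytic_at f x -> real_analytic_at g x.
Proof.
  intros He E (a & d & Hd & H). exists a, (Rmin d e). split; [now apply Rmin_glb_lt|].
  intros y Hy. pose proof (Rmin_l d e). pose proof (Rmin_r d e).
  rewrite <- E by lra. apply H. lra.
Qed.

Lemma real_analytic_mult f g x : real_analytic_at f x -> real_analytic_at g x ->
  real_analytic_at (fun y => f y * g y) x.
Proof.
  intros (a & d & Hd & Ha) (b & e & He & Hb). exists (PS_mult a b), (Rmin d e).
  split; [now apply Rmin_glb_lt|]. intros y Hy.
  pose proof (Rmin_l d e). pose proof (Rmin_r d e).
  apply is_pseries_mult; [apply Ha; lra|apply Hb; lra| |].
  - apply (CV_radius_of_is_pseries a d _ (fun t => f (t + x))); [|lra].
    intros t Ht. replace t with (t + x - x) at 1 by ring. apply Ha.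
    now replace (t + x - x) with t by ring.
  - apply (CV_radius_of_is_pseries b e _ (fun t => g (t + x))); [|lra].
    intros t Ht. replace t with (t + x - x) at 1 by ring. apply Hb.
    now replace (t + x - x) with t by ring.
Qed.

Lemma real_analytic_minus f g x : real_analytic_at f x -> real_analytic_at g x ->
  real_analytic_at (fun y => f y - g y) x.
Proof.
  intros (a & d & Hd & Ha) (b & e & He & Hb). exists (PS_minus a b), (Rmin d e).
  split; [now apply Rmin_glb_lt|]. intros y Hy.
  pose proof (Rmin_l d e). pose proof (Rmin_r d e).
  apply (is_pseries_minus a b); [apply Ha|apply Hb]; lra.
Qed.

Lemma real_analytic_const c x : real_analytic_at (fun _ => c) x.
Proof.
  exists (fun n => match n with O => c | _ => 0 end), 1. split; [lra|]. intros y _.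
  apply is_pseries_R, is_series_lim_seq. apply (is_lim_seq_ext (fun _ => c));
    [|apply is_lim_seq_const].
  induction n as [|n IH]; [rewrite sum_O; simpl; ring|]. rewrite sum_n_S, <- IH. ring.
Qed.

Lemma real_analytic_id x : real_analytic_at (fun y => y) x.
Proof.
  exists (fun n => match n with O => x | 1%nat => 1 | _ => 0 end), 1. split; [lra|]. intros y _.
  apply is_pseries_R, is_series_lim_seq, is_lim_seq_incr_1.
  apply (is_lim_seq_ext (fun _ => y)); [|apply is_lim_seq_const].
  induction n as [|n IH]; [rewrite sum_n_S, sum_O; simpl; ring|]. rewrite sum_n_S, <- IH. ring.
Qed.

Lemma real_analytic_pow f n x : real_analytic_at f x -> real_analytic_at (fun y => f y ^ n) x.
Proof.
  intros H. induction n as [|n IH]; [exact (real_analytic_const 1 x)|]. simpl.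
  now apply real_analytic_mult.
Qed.

Lemma real_analytic_exp c x : real_analytic_at (fun y => exp (c * y)) x.
Proof.
  exists (fun n => exp (c * x) * (c ^ n * / INR (Factorial.fact n))), 1. split; [lra|]. intros y _.
  apply is_pseries_R.
  replace (exp (c * y)) with (exp (c * x) * exp (c * (y - x))) by (rewrite <- exp_plus;
    f_equal; ring).
  apply (is_series_ext (fun n => exp (c * x) * (/ INR (Factorial.fact n) * (c * (y - x)) ^ n))).
  { intros n. rewrite Rpow_mult_distr. simpl. ring. }
  apply (is_series_scal_l (exp (c * x)) _ (exp (c * (y - x)))). apply is_pseries_R, is_exp_Reals.
Qed.

(** Continuity of the sum at 0 gives a_0 = 0. For t > 0 the series may then be divided by t, which
    shifts the coefficients and starts the induction again. *)
Lemma pseries_zero_right (a : nat -> R) (d : R) : 0 < d ->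
  (forall t, 0 < t < d -> is_pseries a t 0) -> forall n, a n = 0.
Proof.
  intros Hd H n. revert a H.
  assert (H0 : forall a : nat -> R, (forall t, 0 < t < d -> is_pseries a t 0) -> a O = 0).
  { intros a H.
    assert (Rbar_lt (Rabs 0) (CV_radius a)).
    { rewrite Rabs_R0. apply Rbar_lt_le_trans with (Finite (d / 2)); [simpl; lra|].
      apply Rbar_not_lt_le. intros C. rewrite <- (Rabs_pos_eq (d / 2)) in C by lra.
      apply (CV_disk_outside a (d / 2) C).
      assert (S : ex_series (fun n => a n * (d / 2) ^ n)).
      { exists 0. apply is_pseries_R, H. lra. }
      now apply ex_series_lim_0. }
    assert (C : filterlim (PSeries a) (at_right 0) (locally (PSeries a 0))).
    { eapply filterlim_filter_le_1; [|apply continuity_pt_filterlim, PSeries_continuity; easy].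
      apply filter_le_within. }
    rewrite PSeries_0 in C.
    assert (C' : filterlim (PSeries a) (at_right 0) (locally 0)).
    { apply (filterlim_ext_loc (fun _ => 0)); [|apply filterlim_const].
      exists (mkposreal d Hd). intros y By Hy. symmetry. apply is_pseries_unique, H.
      unfold ball in By; simpl in By; unfold AbsRing_ball, abs, minus, plus, opp in By; simpl in By.
      rewrite Ropp_0, Rplus_0_r in By. apply Rabs_lt_between in By. lra. }
    exact (filterlim_locally_unique _ _ _ C C'). }
  induction n as [|n IH]; intros a H; [now apply H0|].
  change (a (S n)) with (PS_decr_1 a n). apply IH. intros t Ht.
  replace 0 with (scal (/ t) (plus 0 (opp (a O)))).
  - apply (is_pseries_decr_1 a t (/ t) 0); [|now apply H]. apply Rinv_l. lra.
  - rewrite (H0 a H). unfold scal, plus, opp; simpl; unfold mult; simpl. ring.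
Qed.

Lemma real_analytic_zero_right f x e : 0 < e -> real_analytic_at f x ->
  (forall y, x < y < x + e -> f y = 0) ->
  exists d, 0 < d /\ forall y, Rabs (y - x) < d -> f y = 0.
Proof.
  intros He (a & d & Hd & H) Z. exists d. split; [easy|]. intros y Hy.
  assert (A : forall n, a n = 0).
  { apply (pseries_zero_right a (Rmin d e)); [now apply Rmin_glb_lt|]. intros t Ht.
    pose proof (Rmin_l d e). pose proof (Rmin_r d e).
    rewrite <- (Z (x + t)) by lra. replace t with (x + t - x) at 1 by ring. apply H.
    replace (x + t - x) with t by ring. rewrite Rabs_pos_eq; lra. }
  rewrite <- (is_pseries_unique _ _ _ (H y Hy)). unfold PSeries.
  apply is_series_unique, is_series_lim_seq.
  apply (is_lim_seq_ext (fun _ => 0)); [|apply is_lim_seq_const].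
  induction n as [|n IH]; [rewrite sum_O|rewrite sum_n_S, <- IH]; rewrite A; ring.
Qed.

(** Connectedness argument: at the left end of the zero interval all Taylor coefficients vanish, so
    the interval extends further left unless it has already reached x. *)
Lemma real_analytic_identity f b c : b < c -> (forall x, b < x -> real_analytic_at f x) ->
  (forall x, c < x -> f x = 0) -> forall x, b < x -> f x = 0.
Proof.
  intros Hbc Ha Z.
  intros x Hx. destruct (Rlt_le_dec c x) as [|Hxc]; [now apply Z|].
  (* The left end is encoded by its distance m from c, so that [completeness] supplies the extremal
     one as a supremum. *)
  set (E := fun m => 0 <= m <= c - x /\ forall y, c - m < y -> f y = 0).
  destruct (completeness E) as [m [Hub Hlub]].
  - exists (c - x). now intros t [Ht _].
  - exists 0. split; [lra|]. intros y Hy. apply Z. lra.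
  - assert (0 <= m) by (apply Hub; split; [lra|]; intros y Hy; apply Z; lra).
    assert (m <= c - x) by (apply Hlub; now intros t [Ht _]).
    assert (Zm : forall y, c - m < y -> f y = 0).
    { intros y Hy. apply NNPP. intros N.
      assert (m <= c - y); [|lra]. apply Hlub. intros t [Ht Ht'].
      destruct (Rle_lt_dec t (c - y)); [easy|]. exfalso. apply N, Ht'. lra. }
    destruct (real_analytic_zero_right f (c - m) 1) as (d & Hd & Zd); [lra|apply Ha;
      lra|intros; apply Zm; lra|].
    destruct (Req_dec m (c - x)) as [->|Hne].
    + apply Zd. replace (x - (c - (c - x))) with 0 by ring. now rewrite Rabs_R0.
    + exfalso. set (m' := Rmin (m + d / 2) (c - x)).
      assert (m < m') by (apply Rmin_glb_lt; lra).
      pose proof (Rmin_l (m + d / 2) (c - x)). pose proof (Rmin_r (m + d / 2) (c - x)).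
      assert (E m') as HE; [|specialize (Hub _ HE); lra].
      split; [unfold m' in *; lra|]. intros y Hy. destruct (Rlt_le_dec (c - m) y); [now apply Zm|].
      apply Zd. apply Rabs_def1; unfold m' in *; lra.
Qed.

(** * Analyticity of eta *)

Lemma tannery (f : nat -> nat -> R) (r B : nat -> R) :
  (forall m, is_lim_seq (fun K => f K m) (r m)) ->
  (forall K m, Rabs (f K m) <= B m) -> ex_series B ->
  ex_series r /\ is_lim_seq (fun K => Series (f K)) (Series r).
Proof.
  intros Hr HB SB.
  assert (Hrb : forall m, Rabs (r m) <= B m).
  { intros m. apply (is_lim_seq_le (fun K => Rabs (f K m)) (fun _ => B m) (Rabs (r m)) (B m)); auto.
    - apply (is_lim_seq_abs _ (Finite _)), Hr.
    - apply is_lim_seq_const. }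
  assert (Er : ex_series r) by now apply (ex_series_le r B).
  assert (Ef : forall K, ex_series (f K)) by (intros K; now apply (ex_series_le (f K) B)).
  split; [easy|].
  set (tail := fun M => Series (fun m => B (S M + m)%nat)).
  assert (Ht : forall g M, (forall m, Rabs (g m) <= B m) ->
    Rabs (Series g - sum_n g M) <= tail M).
  { intros g M Hg. assert (Eg : ex_series g) by now apply (ex_series_le g B).
    rewrite (Series_incr_n g (S M)) by (auto; lia). simpl Nat.pred.
    replace (sum_f_R0 g M + _ - sum_n g M) with (Series (fun m => g (S M + m)%nat))
      by (rewrite sum_n_Reals; ring).
    apply Rle_trans with (Series (fun m => Rabs (g (S M + m)%nat))).
    - apply Series_Rabs. apply (ex_series_le (fun m => Rabs (g (S M + m)%nat)) (fun m => B (S M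
        + m)%nat)).
      + intros n. unfold norm; simpl. unfold abs; simpl. rewrite Rabs_Rabsolu. apply Hg.
      + now apply ex_series_incr_n.
    - apply Series_le; [|now apply ex_series_incr_n]. intros n. split; [apply Rabs_pos|apply Hg]. }
  assert (Lt : is_lim_seq tail 0).
  { apply (is_lim_seq_ext (fun M => Series B - sum_n B M)).
    - intros M. unfold tail. rewrite (Series_incr_n B (S M)) by (auto; lia).
      simpl Nat.pred. rewrite sum_n_Reals. ring.
    - replace 0 with (Series B - Series B) by ring.
      apply is_lim_seq_minus'; [apply is_lim_seq_const|]. exact (Series_correct B SB). }
  apply is_lim_seq_spec. intros eps.
  (* Two tails, each below eps / 4, and a finite head below eps / 2. *)
  apply is_lim_seq_spec in Lt. destruct (Lt (pos_div_2 (pos_div_2 eps))) as [M HM].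
  specialize (HM M (le_n M)). simpl in HM. rewrite Rminus_0_r in HM. apply Rabs_lt_between in HM.
  assert (Ls : is_lim_seq (fun K => sum_n (f K) M) (sum_n r M)).
  { clear - Hr. induction M as [|M IH].
    - rewrite sum_O. apply (is_lim_seq_ext (fun K => f K O)); [|apply Hr]. intros K.
      now rewrite sum_O.
    - rewrite sum_n_S. apply (is_lim_seq_ext (fun K => sum_n (f K) M + f K (S M))).
      + intros K. now rewrite sum_n_S.
      + now apply is_lim_seq_plus'. }
  apply is_lim_seq_spec in Ls. destruct (Ls (pos_div_2 eps)) as [K0 HK].
  exists K0. intros K HKK. specialize (HK K HKK). simpl in HK.
  pose proof (Ht (f K) M (HB K)) as T1. pose proof (Ht r M Hrb) as T2.
  apply Rabs_le_between in T1. apply Rabs_le_between in T2. apply Rabs_lt_between in HK.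
  apply Rabs_lt_between. lra.
Qed.

Lemma Series_finite_sum (b : nat -> nat -> R) K : (forall k, ex_series (b k)) ->
  Series (fun m => sum_n (fun k => b k m) K) = sum_n (fun k => Series (b k)) K /\
  ex_series (fun m => sum_n (fun k => b k m) K).
Proof.
  intros H. induction K as [|K [IH1 IH2]].
  - rewrite sum_O. split.
    + apply Series_ext. intros m. now rewrite sum_O.
    + apply (ex_series_ext (b O)); [|easy]. intros m. now rewrite sum_O.
  - rewrite sum_n_S, <- IH1. rewrite <- Series_plus by easy. split.
    + apply Series_ext. intros m. now rewrite sum_n_S.
    + apply (ex_series_ext (fun m => sum_n (fun k => b k m) K + b (S K) m)).
      * intros m. now rewrite sum_n_S.
      * now apply (ex_series_plus (fun m => sum_n (fun k => b k m) K)).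
Qed.

Lemma exp_partial_bound z n : Rabs (sum_n (fun k => z ^ k / INR (Factorial.fact k)) n) <=
  exp (Rabs z).
Proof.
  rewrite sum_n_Reals. eapply Rle_trans; [apply Rsum_abs|].
  eapply Rle_trans; [|apply (exp_ge_taylor (Rabs z) n), Rabs_pos].
  apply Req_le, sum_eq. intros i _. pose proof (lt_INR 0 _ (Factorial.lt_O_fact i)).
  unfold Rdiv. rewrite Rabs_mult, RPow_abs, Rabs_inv, (Rabs_pos_eq (INR _)) by (simpl in *; lra).
  easy.
Qed.

(** Integral comparison in telescoping form: by the mean value theorem (x + 1)^(-1-e) <= (x^-e - (x
    + 1)^-e) / e. *)
Lemma ex_series_inv_Rpower e : 0 < e -> ex_series (fun n => exp (- ((1 + e) * ln (INR (n + 1))))).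
Proof.
  intros He. apply (ex_series_incr_1 (fun n => exp (- ((1 + e) * ln (INR (n + 1)))))).
  set (g := fun n => exp (- (e * ln (INR (n + 1))))).
  apply (ex_series_le (fun n => exp (- ((1 + e) * ln (INR (S n + 1))))) (fun n => / e * (g n -
    g (S n)))).
  - intros n. change (Rabs (exp (- ((1 + e) * ln (INR (S n + 1))))) <= / e * (g n - g (S n))).
    rewrite Rabs_pos_eq by (left; apply exp_pos).
    unfold g. pose proof (INR_S_pos n) as Hn.
    replace (INR (S n + 1)) with (INR (n + 1) + 1) by (rewrite !plus_INR, (S_INR n); simpl; ring).
    set (x := INR (n + 1)) in *.
    destruct (MVT_cor2 (fun y => exp (- (e * ln y))) (fun y => - e * exp (- ((1 + e) * ln y)))
      x (x + 1)) as (c & E & B); [lra| |].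
    { intros c Hc. apply is_derive_Reals. auto_derive; [lra|].
      replace (- ((1 + e) * ln c)) with (- (e * ln c) + - ln c) by ring.
      rewrite exp_plus, (exp_Ropp (ln c)), exp_ln by lra. field. lra. }
    replace (/ e * (exp (- (e * ln x)) - exp (- (e * ln (x + 1))))) with (exp (- ((1 + e) * ln c))).
    + apply exp_le, Ropp_le_contravar, Rmult_le_compat_l; [lra|]. apply ln_le; lra.
    + replace (exp (- (e * ln x)) - exp (- (e * ln (x + 1)))) with (e * exp (- ((1 + e) * ln
        c))) by lra. field. lra.
  - apply (ex_series_scal_l (/ e) (fun n => g n - g (S n))). exists (g O - 0).
    apply is_series_lim_seq. apply (is_lim_seq_ext (fun n => g O - g (S n))).
    + induction n as [|n IH]; [now rewrite sum_O|]. rewrite sum_n_S, <- IH. ring.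
    + apply is_lim_seq_minus'; [apply is_lim_seq_const|]. apply -> is_lim_seq_incr_1.
      apply (is_lim_seq_ext (fun n => dpow 0 (INR (n + 1)) e)); [|now apply is_lim_seq_dpow0].
      intros n. unfold g, dpow. simpl. ring.
Qed.

(** Pairing consecutive terms makes the eta series absolutely convergent for every s > 0, as
    dominated convergence requires. *)
Definition odd_minus_even (f : R -> R) (m : nat) : R := f (INR (2 * m + 1)) - f (INR (2 * m + 2)).

Lemma is_series_eta_pairs s : 0 < s -> is_series (odd_minus_even (fun y => dpow 0 y s))
  (dirichlet_eta s).
Proof.
  intros Hs. apply is_series_lim_seq.
  apply (is_lim_seq_ext (fun M => sum_n (eta_term s) (2 * M + 1))).
  - assert (E : forall M, eta_term s (2 * M) + eta_term s (S (2 * M)) =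
      odd_minus_even (fun y => dpow 0 y s) M).
    { intros M. unfold eta_term, odd_minus_even. cbn [pow]. rewrite pow_1_even.
      replace (S (2 * M) + 1)%nat with (2 * M + 2)%nat by lia. ring. }
    intros M. induction M as [|M IH].
    + replace (2 * 0 + 1)%nat with 1%nat by lia. rewrite sum_n_S, !sum_O. exact (E O).
    + replace (2 * S M + 1)%nat with (S (S (2 * M + 1))) by lia.
      rewrite !sum_n_S, IH, <- (E (S M)). replace (2 * S M)%nat with (S (2 * M + 1)) by lia. ring.
  - apply (is_lim_seq_subseq (sum_n (eta_term s)) _ (fun M => (2 * M + 1)%nat)).
    + apply eventually_subseq. intros n. lia.
    + now apply is_series_eta.
Qed.

Definition exp_sum (K : nat) (z : R) : R := sum_n (fun k => z ^ k / INR (Factorial.fact k)) K.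

Lemma is_derive_exp_sum K z :
  is_derive (exp_sum K) z (match K with O => 0 | S j => exp_sum j z end).
Proof.
  unfold exp_sum. induction K as [|K IH].
  - apply (is_derive_ext (fun _ => 1)); [|apply (is_derive_const 1)]. intros t. rewrite sum_O.
    simpl. field.
  - apply (is_derive_ext (fun z => sum_n (fun k => z ^ k / INR (Factorial.fact k)) K + z ^ S K
      / INR (Factorial.fact (S K)))).
    { intros t. now rewrite sum_n_S. }
    replace (sum_n _ K) with (match K with O => 0 | S j => sum_n (fun k => z ^ k / INR
      (Factorial.fact k)) j end
      + z ^ K / INR (Factorial.fact K)).
    + apply (is_derive_plus (fun z => sum_n _ K) (fun z => z ^ S K / _)); [exact IH|].
      rewrite fact_simpl, mult_INR. set (c := INR (S K)). set (c' := INR (Factorial.fact K)).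
      auto_derive; [easy|]. simpl Nat.pred.
      change (1 * (c * z ^ K) * / (c * c') = z ^ K / c').
      field. split; apply not_0_INR; [apply Factorial.fact_neq_0|lia].
    + destruct K; [rewrite sum_O; ring|now rewrite sum_n_S].
Qed.

(** Mean value theorem in y. Since |h| <= s / 2, every truncation of c^-h is at most c^(s/2) in
    absolute value, so half of the decay of c^-s survives, with a bound that does not depend on
    K. *)
Lemma odd_minus_even_bound s h K m : 0 < s -> Rabs h <= s / 2 ->
  Rabs (odd_minus_even (fun y => exp (- (s * ln y)) * exp_sum K (- (h * ln y))) m)
    <= 2 * s * exp (- ((1 + s / 2) * ln (INR (m + 1)))).
Proof.
  intros Hs Hh. unfold odd_minus_even.
  set (x := INR (2 * m + 1)).
  replace (INR (2 * m + 2)) with (x + 1) by (unfold x; rewrite !plus_INR; simpl; ring).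
  set (d := fun z => match K with O => 0 | S j => exp_sum j z end).
  assert (Hx : INR (m + 1) <= x) by (apply le_INR; lia).
  pose proof (INR_S_pos m).
  assert (1 <= x) by (unfold x; rewrite plus_INR; pose proof (pos_INR (2 * m)); simpl in *; lra).
  destruct (MVT_cor2 (fun y => exp (- (s * ln y)) * exp_sum K (- (h * ln y)))
    (fun y => exp (- (s * ln y)) / y * (- s * exp_sum K (- (h * ln y)) - h * d (- (h * ln y))))
      x (x + 1))
    as (c & E & Bc); [lra| |].
  { intros c Hc. apply is_derive_Reals.
    replace (exp (- (s * ln c)) / c * _) with
      (plus (mult (- s / c * exp (- (s * ln c))) (exp_sum K (- (h * ln c))))
        (mult (exp (- (s * ln c))) (scal (- h / c) (d (- (h * ln c)))))).
    - apply (is_derive_mult (fun y => exp (- (s * ln y))) (fun y => exp_sum K (- (h * ln y)))).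
      + auto_derive; [lra|]. field. lra.
      + apply (is_derive_comp (exp_sum K) (fun y => - (h * ln y))); [apply is_derive_exp_sum|].
        auto_derive; [lra|]. field. lra.
      + intros; apply Rmult_comm.
    - unfold plus, mult, scal; simpl; unfold mult; simpl. field. lra. }
  rewrite Rabs_minus_sym, E. replace (x + 1 - x) with 1 by ring. rewrite Rmult_1_r.
  assert (0 <= ln c) by (rewrite <- ln_1; apply ln_le; lra).
  assert (HA : Rabs (- (h * ln c)) <= s / 2 * ln c).
  { rewrite Rabs_Ropp, Rabs_mult, (Rabs_pos_eq (ln c)) by easy. now apply Rmult_le_compat_r. }
  assert (HE : forall j, Rabs (exp_sum j (- (h * ln c))) <= exp (s / 2 * ln c)).
  { intros j. eapply Rle_trans; [apply exp_partial_bound|]. now apply exp_le. }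
  assert (HD : Rabs (d (- (h * ln c))) <= exp (s / 2 * ln c)).
  { unfold d. destruct K; [|apply HE]. rewrite Rabs_R0. left. apply exp_pos. }
  specialize (HE K). pose proof (exp_pos (s / 2 * ln c)).
  rewrite Rabs_mult, Rabs_pos_eq by (left; apply Rdiv_lt_0_compat; [apply exp_pos|lra]).
  assert (HN : Rabs (- s * exp_sum K (- (h * ln c)) - h * d (- (h * ln c))) <=
    2 * s * exp (s / 2 * ln c)).
  { eapply Rle_trans; [apply Rabs_triang|].
    rewrite Rabs_Ropp, !Rabs_mult, Rabs_Ropp, (Rabs_pos_eq s) by lra.
    pose proof (Rabs_pos h). pose proof (Rabs_pos (d (- (h * ln c)))).
    assert (Rabs h * Rabs (d (- (h * ln c))) <= s * exp (s / 2 * ln c))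
      by (apply Rmult_le_compat; lra).
    assert (s * Rabs (exp_sum K (- (h * ln c))) <= s * exp (s / 2 * ln c))
      by (apply Rmult_le_compat_l; lra).
    lra. }
  apply Rle_trans with (exp (- (s * ln c)) / c * (2 * s * exp (s / 2 * ln c))).
  { apply Rmult_le_compat_l; [left; apply Rdiv_lt_0_compat; [apply exp_pos|lra]|easy]. }
  replace (exp (- (s * ln c)) / c * (2 * s * exp (s / 2 * ln c))) with
    (2 * s * exp (- ((1 + s / 2) * ln c))).
  - apply Rmult_le_compat_l; [lra|]. apply exp_le, Ropp_le_contravar, Rmult_le_compat_l; [lra|].
    apply ln_le; lra.
  - replace (- ((1 + s / 2) * ln c)) with (- (s * ln c) + - ln c + s / 2 * ln c) by field.
    rewrite !exp_plus, (exp_Ropp (ln c)), exp_ln by lra. field. lra.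
Qed.

Lemma is_lim_seq_exp_sum z : is_lim_seq (fun K => exp_sum K z) (exp z).
Proof.
  pose proof (proj1 (is_pseries_R _ _ _) (is_exp_Reals z)) as H.
  apply (is_lim_seq_ext (sum_n (fun n => / INR (Factorial.fact n) * z ^ n))); [|exact H].
  intros n. apply sum_n_ext. intros k. apply Rmult_comm.
Qed.

(** For s + h, each y^-(s+h) is y^-s exp (- h ln y). Truncating the exponential at degree K gives a
    polynomial in h, for which summation over the pairs commutes with the finite sum over degrees;
    [tannery] then lets K tend to infinity under the common majorant [B]. *)
Lemma eta_real_analytic s : 0 < s -> real_analytic_at dirichlet_eta s.
Proof.
  intros Hs.
  set (F := fun h K => odd_minus_even (fun y => exp (- (s * ln y)) * exp_sum K (- (h * ln y)))).
  set (B := fun m => 2 * s * exp (- ((1 + s / 2) * ln (INR (m + 1))))).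
  assert (SB : ex_series B).
  { apply (ex_series_scal_l (2 * s) (fun m => exp (- ((1 + s / 2) * ln (INR (m + 1)))))).
    apply ex_series_inv_Rpower. lra. }
  assert (HF : forall h K m, Rabs h <= s / 2 -> Rabs (F h K m) <= B m).
  { intros h K m Hh. now apply odd_minus_even_bound. }
  set (b := fun k m => odd_minus_even (fun y => dpow k y s) m / INR (Factorial.fact k)).
  assert (Fb : forall h K m, F h K m = sum_n (fun k => b k m * h ^ k) K).
  { intros h K m. unfold F, b, odd_minus_even.
    set (y1 := INR (2 * m + 1)). set (y2 := INR (2 * m + 2)).
    assert (E0 : forall y k, exp (- (s * ln y)) * ((- (h * ln y)) ^ k / INR (Factorial.fact k)) =
      dpow k y s / INR (Factorial.fact k) * h ^ k).
    { intros y k. unfold dpow. replace (- (h * ln y)) with (- ln y * h) by ring.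
      rewrite Rpow_mult_distr. field. apply INR_fact_neq_0. }
    assert (E : forall y, exp (- (s * ln y)) * exp_sum K (- (h * ln y)) =
      sum_n (fun k => dpow k y s / INR (Factorial.fact k) * h ^ k) K).
    { intros y. unfold exp_sum. rewrite <- (sum_n_mult_l (exp (- (s * ln y)))). apply sum_n_ext.
      intros k.
      apply E0. }
    rewrite !E. clear E. induction K as [|K IH].
    - rewrite !sum_O. field. apply INR_fact_neq_0.
    - rewrite !sum_n_S, <- IH. field. apply INR_fact_neq_0. }
  (* No separate estimate of the coefficients is made: at h = s / 2 the term of degree k is the
     difference of two consecutive truncations, both dominated by [B]. *)
  assert (Eb : forall k, ex_series (b k)).
  { assert (Hh : Rabs (s / 2) <= s / 2) by (rewrite Rabs_pos_eq; lra).
    assert (EF : forall K, ex_series (F (s / 2) K)).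
    { intros K. apply (ex_series_le (F (s / 2) K) B); [|easy]. intros m. now apply HF. }
    intros k. apply (ex_series_ext (fun m => / (s / 2) ^ k * (b k m * (s / 2) ^ k))).
    { intros m. rewrite (Rmult_comm (b k m)), <- Rmult_assoc, Rinv_l by (apply pow_nonzero; lra).
      apply Rmult_1_l. }
    apply (ex_series_scal_l (/ (s / 2) ^ k) (fun m => b k m * (s / 2) ^ k)).
    destruct k as [|k].
    - apply (ex_series_ext (F (s / 2) O)); [|easy]. intros m. now rewrite Fb, sum_O.
    - apply (ex_series_ext (fun m => F (s / 2) (S k) m - F (s / 2) k m)).
      + intros m. rewrite !Fb, sum_n_S. apply Rplus_minus_l.
      + now apply (ex_series_minus (F (s / 2) (S k))). }
  exists (fun k => Series (b k)), (s / 2). split; [lra|]. intros y Hy.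
  set (h := y - s) in *. apply Rabs_lt_between in Hy as Hy'.
  apply is_pseries_R, is_series_lim_seq.
  rewrite <- (is_series_unique _ _ (is_series_eta_pairs y ltac:(unfold h in *; lra))).
  apply (is_lim_seq_ext (fun K => Series (F h K))).
  - intros K.
    rewrite (Series_ext _ (fun m => sum_n (fun k => b k m * h ^ k) K)) by (intros; apply Fb).
    rewrite (proj1 (Series_finite_sum (fun k m => b k m * h ^ k) K
      ltac:(intros k; now apply (ex_series_scal_r (h ^ k) (b k))))).
    apply sum_n_ext. intros k. apply Series_scal_r.
  - apply (tannery (F h) _ B); [|intros; apply HF; lra|easy].
    intros m. unfold F, odd_minus_even.
    assert (L : forall y0, is_lim_seq (fun K => exp (- (s * ln y0)) * exp_sum K (- (h * ln
      y0))) (dpow 0 y0 y)).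
    { intros y0. replace (dpow 0 y0 y) with (exp (- (s * ln y0)) * exp (- (h * ln y0))).
      - apply (is_lim_seq_scal_l _ _ (Finite _)), is_lim_seq_exp_sum.
      - unfold dpow. rewrite <- exp_plus. simpl. rewrite Rmult_1_l. f_equal. unfold h. ring. }
    apply is_lim_seq_minus'; apply L.
Qed.

(** * From the complex zeta function to the real line *)

Lemma is_series_Re (a : nat -> C) (l : C) :
  @is_series C_AbsRing C_NormedModule a l -> is_series (fun n => Re (a n)) (Re l).
Proof.
  intros H.
  apply (filterlim_ext (fun n => Re (@sum_n C_AbelianMonoid a n))).
  - induction x as [|n IH]; [now rewrite !sum_O|]. rewrite !sum_Sn, <- IH. reflexivity.
  - eapply filterlim_comp; [exact H|]. intros P [e He]. exists e. intros y Hy. apply He, Hy.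
Qed.

Lemma is_pseries_Re (a : nat -> C) (h : R) (l : C) :
  @is_pseries C_AbsRing C_NormedModule a (RtoC h) l -> is_pseries (fun n => Re (a n)) h (Re l).
Proof.
  intros H. apply is_pseries_R. apply is_series_Re in H.
  eapply is_series_ext; [|exact H]. intros n. simpl.
  assert (E : @pow_n C_Ring (RtoC h) n = RtoC (h ^ n)).
  { induction n as [|n IH]; [reflexivity|].
    change (pow_n (RtoC h) (S n)) with (Cmult (RtoC h) (pow_n (RtoC h) n)).
    rewrite IH. simpl. now rewrite RtoC_mult. }
  change (Re (Cmult (@pow_n C_Ring (RtoC h) n) (a n)) = Re (a n) * h ^ n).
  rewrite E, re_scal_l. apply Rmult_comm.
Qed.

Lemma ball_RtoC (x y : R) (d : posreal) : Rabs (y - x) < d -> ball (RtoC x) d (RtoC y).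
Proof.
  intros H. split; [exact H|]. apply ball_center.
Qed.

Lemma on_reals_analytic (f : C -> C) (x : R) : analytic_at f (RtoC x) ->
  real_analytic_at (on_reals f) x.
Proof.
  intros (a & d & H). exists (fun n => Re (a n)), d. split; [apply cond_pos|].
  intros y Hy. apply is_pseries_Re. rewrite RtoC_minus. now apply H, ball_RtoC.
Qed.

Lemma zeta_pole_cleared (zeta : C -> C) : is_riemann_zeta zeta ->
  exists (N : nat) (F : R -> R), (forall x, real_analytic_at F x) /\
    forall x, x <> 1 -> F x = (x - 1) ^ N * on_reals zeta x.
Proof.
  intros (Ha & (N & a & [d Hd]) & _). exists N.
  (* Since [zeta 1] is arbitrary, the value at 1 has to be the constant coefficient of the series
     that clears the pole. *)
  exists (fun x => if Req_EM_T x 1 then Re (a O) else (x - 1) ^ N * on_reals zeta x).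
  split; [|intros x Hx; now destruct (Req_EM_T x 1)].
  intros x. destruct (Req_dec x 1) as [->|Hx].
  - exists (fun n => Re (a n)), d. split; [apply cond_pos|]. intros y Hy.
    destruct (Req_EM_T y 1) as [->|Hy1].
    + rewrite Rminus_diag. apply (is_pseries_0 (fun n => Re (a n))).
    + replace ((y - 1) ^ N * on_reals zeta y) with (Re (Cpow (RtoC y - RtoC 1) N * zeta (RtoC
        y))%C).
      * apply is_pseries_Re. rewrite RtoC_minus. apply Hd; [now apply ball_RtoC|].
        intros E. apply Hy1. now apply RtoC_inj.
      * rewrite <- RtoC_minus, <- RtoC_pow, re_scal_l. reflexivity.
  - apply (real_analytic_ext_loc (fun y => (y - 1) ^ N * on_reals zeta y) _ x (Rabs (x - 1))).
    + apply Rabs_pos_lt. lra.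
    + intros y Hy. destruct (Req_EM_T y 1) as [->|]; [|easy].
      rewrite Rabs_minus_sym in Hy. lra.
    + apply real_analytic_mult.
      * apply (real_analytic_pow (fun y => y - 1)), (real_analytic_minus (fun y => y) (fun _ => 1)).
        apply real_analytic_id. apply real_analytic_const.
      * apply on_reals_analytic, Ha. intros E. now apply Hx, RtoC_inj.
Qed.

Lemma zeta_series (zeta : C -> C) s : is_riemann_zeta zeta -> 1 < s ->
  is_series (fun n => dpow 0 (INR (n + 1)) s) (on_reals zeta s).
Proof.
  intros (_ & _ & H) Hs. pose proof (is_series_Re _ _ (H (RtoC s) Hs)) as HS.
  eapply is_series_ext; [|exact HS]. intros n. cbv beta.
  replace (- RtoC s * RtoC (ln (INR (n + 1))))%C with (RtoC (- (s * ln (INR (n + 1))))).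
  - unfold Cexp, dpow. simpl. rewrite cos_0. ring.
  - rewrite <- RtoC_opp, <- RtoC_mult. f_equal. ring.
Qed.

(** Twice the term at 2 (M + 1) is 2^(1-s) times the term at M + 1. So the identity already holds
    for finite sums, with 2 M + 2 terms against M + 1, and both sides converge. *)
Lemma eta_zeta_gt_1 (zeta : C -> C) s : is_riemann_zeta zeta -> 1 < s ->
  dirichlet_eta s = (1 - exp ((1 - s) * ln 2)) * on_reals zeta s.
Proof.
  intros Hz Hs. pose proof (zeta_series zeta s Hz Hs) as HS.
  set (f := fun n => dpow 0 (INR (n + 1)) s) in *. set (z := on_reals zeta s) in *.
  set (q := exp ((1 - s) * ln 2)).
  assert (H : is_lim_seq (sum_n (odd_minus_even (fun y => dpow 0 y s))) ((1 - q) * z)).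
  2: { rewrite <- (is_series_unique _ _ (is_series_eta_pairs s ltac:(lra))).
       now apply is_series_unique, is_series_lim_seq. }
  apply (is_lim_seq_ext (fun M => sum_n f (2 * M + 1) - q * sum_n f M)).
  - assert (E : forall M, f (2 * M)%nat + f (S (2 * M)) - q * f M =
      odd_minus_even (fun y => dpow 0 y s) M).
    { intros M. unfold f, odd_minus_even. replace (S (2 * M) + 1)%nat with (2 * M + 2)%nat by lia.
      replace (q * dpow 0 (INR (M + 1)) s) with (2 * dpow 0 (INR (2 * M + 2)) s); [ring|].
      replace (2 * M + 2)%nat with (2 * (M + 1))%nat by lia. rewrite mult_INR.
      unfold dpow, q. rewrite ln_mult by (try apply INR_S_pos; simpl; lra).
      change (INR 2) with 2. simpl. rewrite !Rmult_1_l, <- exp_plus.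
      rewrite <- (exp_ln 2) at 1 by lra. rewrite <- exp_plus. f_equal. ring. }
    intros M. induction M as [|M IH].
    + replace (2 * 0 + 1)%nat with 1%nat by lia. rewrite sum_n_S, !sum_O. exact (E O).
    + replace (2 * S M + 1)%nat with (S (S (2 * M + 1))) by lia.
      rewrite !sum_n_S, <- IH, <- (E (S M)). replace (2 * S M)%nat with (S (2 * M + 1)) by lia.
      ring.
  - replace ((1 - q) * z) with (z - q * z) by ring. apply is_lim_seq_minus'.
    + apply (is_lim_seq_subseq (sum_n f) _ (fun M => (2 * M + 1)%nat)); [|exact HS].
      apply eventually_subseq. intros n. lia.
    + apply (is_lim_seq_scal_l _ _ (Finite z)). exact HS.
Qed.

Lemma eta_zeta (zeta : C -> C) x : is_riemann_zeta zeta -> 0 < x < 1 ->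
  dirichlet_eta x = (1 - exp ((1 - x) * ln 2)) * on_reals zeta x.
Proof.
  intros Hz Hx. destruct (zeta_pole_cleared zeta Hz) as (N & F & HF & E).
  (* 2^(1-y) is split as exp (ln 2) * exp (- ln 2 * y) to match the form exp (c * y) known to be
     analytic. *)
  assert (H : forall y, 0 < y -> (1 - exp (ln 2) * exp (- ln 2 * y)) * F y - (y - 1) ^ N *
    dirichlet_eta y = 0).
  { apply (real_analytic_identity _ 0 1); [lra| |].
    - intros y Hy.
      apply (real_analytic_minus (fun y => _ * F y) (fun y => (y - 1) ^ N * _));
        apply real_analytic_mult.
      + apply (real_analytic_minus (fun _ => 1)); [apply real_analytic_const|].
        apply (real_analytic_mult (fun _ => exp (ln 2)));
          [apply real_analytic_const|apply real_analytic_exp].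
      + apply HF.
      + apply (real_analytic_pow (fun y => y - 1)), (real_analytic_minus (fun y => y) (fun _ => 1)).
        apply real_analytic_id. apply real_analytic_const.
      + now apply eta_real_analytic.
    - intros y Hy. rewrite E, <- exp_plus, (eta_zeta_gt_1 zeta y Hz Hy) by lra.
      replace (ln 2 + - ln 2 * y) with ((1 - y) * ln 2) by ring. ring. }
  specialize (H x (proj1 Hx)). rewrite E, <- exp_plus in H by lra.
  replace (ln 2 + - ln 2 * x) with ((1 - x) * ln 2) in H by ring.
  apply Rmult_eq_reg_l with ((x - 1) ^ N); [lra|]. apply pow_nonzero. lra.
Qed.

(** * Harmonic means *)

Lemma exp_convex u v t : 0 < t < 1 -> exp (t * u + (1 - t) * v) <= t * exp u + (1 - t) * exp v.
Proof.
  intros Ht. set (w := t * u + (1 - t) * v).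
  assert (H : forall x, exp w * (1 + (x - w)) <= exp x).
  { intros x. replace (exp x) with (exp w * exp (x - w)) by (rewrite <- exp_plus; f_equal; ring).
    apply Rmult_le_compat_l; [left; apply exp_pos|apply exp_ineq1_le]. }
  pose proof (H u). pose proof (H v).
  assert (t * (exp w * (1 + (u - w))) <= t * exp u) by (apply Rmult_le_compat_l; lra).
  assert ((1 - t) * (exp w * (1 + (v - w))) <= (1 - t) * exp v) by (apply Rmult_le_compat_l; lra).
  assert (exp w = t * (exp w * (1 + (u - w))) + (1 - t) * (exp w * (1 + (v - w))))
    by (unfold w at 3 5; ring).
  lra.
Qed.

(** This is the chord from the limit point (0, 1/2) to (1, ln 2). Concavity of eta is available only
    on (0, 1], so the end 0 is reached through the Euler sums before the limit is taken. *)
Lemma eta_chord x : 0 < x < 1 -> (1 - x) / 2 + x * ln 2 <= dirichlet_eta x.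
Proof.
  intros Hx.
  apply (is_lim_seq_le (fun N => (1 - x) / 2 + x * euler3 0 (S N) 1) (fun N => euler3 0 (S N)
    x) (Finite _) (Finite _)).
  - intros N.
    pose proof (concave_of_derive2 _ _ _ 0 1 (fun s _ => is_derive_euler3 0 (S N) s)
      (fun s _ => is_derive_euler3 1 (S N) s) (euler3_2_nonpos N) 0 1 (1 - x)
      ltac:(lra) ltac:(lra) ltac:(lra) ltac:(lra)) as H.
    rewrite euler3_0_0 in H.
    replace ((1 - x) * 0 + (1 - (1 - x)) * 1) with x in H by ring. lra.
  - apply is_lim_seq_plus'; [apply is_lim_seq_const|].
    rewrite <- eta_1. apply (is_lim_seq_scal_l _ _ (Finite _)), is_lim_seq_euler3. lra.
  - apply is_lim_seq_euler3. lra.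
Qed.

(** The threshold 1/8 serves the zeta limit, whose denominator exceeds 2 - 8 x and hence 1. *)
Lemma filterlim_at_right_0_lipschitz (f : R -> R) l K :
  (forall x, 0 < x < / 8 -> Rabs (f x - l) <= K * x) -> filterlim f (at_right 0) (locally l).
Proof.
  intros H P [e HP].
  set (d := Rmin (/ 8) (e / (Rabs K + 1))).
  pose proof (Rabs_pos K). pose proof (cond_pos e).
  assert (Hd : 0 < d) by (apply Rmin_glb_lt; [lra|apply Rdiv_lt_0_compat; lra]).
  exists (mkposreal d Hd). intros x Bx Hx. apply HP.
  change (Rabs (x - 0) < d) in Bx. rewrite Rminus_0_r, Rabs_pos_eq in Bx by lra.
  pose proof (Rmin_l (/ 8) (e / (Rabs K + 1))). pose proof (Rmin_r (/ 8) (e / (Rabs K + 1))).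
  change (Rabs (f x - l) < e). eapply Rle_lt_trans; [apply H; unfold d in *; lra|].
  assert (x * (Rabs K + 1) < e) by (apply Rlt_div_r; unfold d in *; lra).
  pose proof (Rle_abs K). nra.
Qed.

Lemma filterlim_at_left_1_reflect (f : R -> R) l : (forall x, f (1 - x) = f x) ->
  filterlim f (at_right 0) (locally l) -> filterlim f (at_left 1) (locally l).
Proof.
  intros E H. apply (filterlim_ext (fun x => f (1 - x))); [easy|].
  eapply filterlim_comp; [|exact H]. intros P [d HP]. exists d. intros x Bx Hx.
  change (Rabs (x - 1) < d) in Bx. apply HP; [|lra]. change (Rabs (1 - x - 0) < d).
  rewrite <- Rabs_Ropp. now replace (- (1 - x - 0)) with (x - 1) by ring.
Qed.

Lemma harmonic_mean_comm a b : harmonic_mean a b = harmonic_mean b a.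
Proof. unfold harmonic_mean. f_equal; ring. Qed.

Lemma two_pow_chord x : 0 < x < 1 -> exp ((1 - x) * ln 2) - 1 <= 1 - x.
Proof.
  intros Hx. pose proof (exp_convex (ln 2) 0 (1 - x) ltac:(lra)) as H.
  rewrite Rmult_0_r, Rplus_0_r, exp_0, exp_ln in H by lra. lra.
Qed.

Lemma two_pow_gt_1 x : 0 < x < 1 -> 1 - 2 * x < exp ((1 - x) * ln 2) - 1 /\ 0 <
  exp ((1 - x) * ln 2) - 1.
Proof.
  intros Hx. pose proof ln2_bounds. split.
  - replace ((1 - x) * ln 2) with (ln 2 + - x * ln 2) by ring. rewrite exp_plus, exp_ln by lra.
    pose proof (exp_ineq1_le (- x * ln 2)). nra.
  - pose proof (exp_ineq1_le ((1 - x) * ln 2)). nra.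
Qed.

(* [- 1 / zeta] is the product of the decreasing convex functions [2^(1-x) - 1] and [1 / eta]. *)
Lemma two_pow_div_eta_convex x y t : 0 < x -> x < y -> y < 1 -> 0 < t < 1 ->
  (exp ((1 - (t * x + (1 - t) * y)) * ln 2) - 1) / dirichlet_eta (t * x + (1 - t) * y) <
  t * ((exp ((1 - x) * ln 2) - 1) / dirichlet_eta x) + (1 - t) * ((exp ((1 - y) * ln 2) - 1) /
    dirichlet_eta y).
Proof.
  intros Hx Hxy Hy Ht. pose proof ln2_bounds.
  pose proof (eta_concave x y t Hx Hxy ltac:(lra) Ht) as HC.
  pose proof (eta_increasing x y Hx Hxy ltac:(lra)) as HI.
  pose proof (eta_near_0 x ltac:(lra)).
  destruct (two_pow_gt_1 y ltac:(lra)) as [_ Py].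
  pose proof (exp_convex ((1 - x) * ln 2) ((1 - y) * ln 2) t Ht) as HE.
  replace (t * ((1 - x) * ln 2) + (1 - t) * ((1 - y) * ln 2)) with ((1 - (t * x + (1 - t) * y))
    * ln 2) in HE by ring.
  assert (HD : exp ((1 - y) * ln 2) < exp ((1 - x) * ln 2)) by (apply exp_increasing; nra).
  set (ex := dirichlet_eta x) in *. set (ey := dirichlet_eta y) in *.
  set (cx := exp ((1 - x) * ln 2)) in *. set (cy := exp ((1 - y) * ln 2)) in *.
  set (ez := dirichlet_eta _) in *. set (cz := exp _) in HE |- *.
  set (u := (cx - 1) / ex). set (v := (cy - 1) / ey).
  assert (Hu : cx - 1 = u * ex) by (unfold u; field; lra).
  assert (Hv : cy - 1 = v * ey) by (unfold v; field; lra).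
  assert (Huv : v < u).
  { apply Rlt_trans with ((cy - 1) / ex).
    - apply Rmult_lt_compat_l; [lra|]. apply Rinv_lt_contravar; nra.
    - apply Rmult_lt_compat_r; [|lra]. apply Rinv_0_lt_compat. lra. }
  assert (0 < v) by (apply Rdiv_lt_0_compat; lra).
  assert (0 < t * ex + (1 - t) * ey) by nra.
  apply Rlt_div_l; [lra|].
  (* The pairs (u, v) and (ex, ey) are oppositely ordered, so the product of the weighted means
     exceeds the weighted mean of the products by t (1 - t) (u - v) (ey - ex) > 0, as in Chebyshev's
     inequality. Concavity of eta then replaces the mean of ex, ey by the value [ez]. *)
  apply Rlt_le_trans with ((t * u + (1 - t) * v) * (t * ex + (1 - t) * ey)).
  - assert (0 < t * (1 - t) * ((u - v) * (ey - ex))).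
    { apply Rmult_lt_0_compat; apply Rmult_lt_0_compat; lra. }
    replace ((t * u + (1 - t) * v) * (t * ex + (1 - t) * ey)) with
      (t * (u * ex) + (1 - t) * (v * ey) + t * (1 - t) * ((u - v) * (ey - ex))) by ring.
    rewrite <- Hu, <- Hv. lra.
  - apply Rmult_le_compat_l; [|lra]. nra.
Qed.

Theorem proposition2p9 :
  forall zetaC : C -> C, is_riemann_zeta zetaC ->
  let zeta : R -> R := on_reals zetaC in
  let Hz : R -> R := fun x => harmonic_mean (zeta x) (zeta (1 - x)) in
  let He : R -> R :=
    fun x => harmonic_mean (dirichlet_eta x) (dirichlet_eta (1 - x)) in
  strictly_concave_on 0 1 (fun x => 1 / zeta x) /\
  ((forall x : R, 0 < x < 1 ->
      zeta (1 / 2) <= Hz x /\ Hz x < -1 /\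
      (zeta (1 / 2) = Hz x <-> x = 1 / 2)) /\
   filterlim Hz (at_right 0) (locally (-1)) /\
   filterlim Hz (at_left 1) (locally (-1))) /\
  ((forall x : R, 0 < x < 1 ->
      ln 4 / (1 + ln 4) < He x /\
      He x <= (1 - sqrt 2) * zeta (1 / 2) /\
      (He x = (1 - sqrt 2) * zeta (1 / 2) <-> x = 1 / 2)) /\
   filterlim He (at_right 0) (locally (ln 4 / (1 + ln 4))) /\
   filterlim He (at_left 1) (locally (ln 4 / (1 + ln 4)))).
Proof.
  intros zetaC HC zeta Hz He.
  (* [w] will be - 1 / zeta on (0,1), so that [Hz x] = - 2 / (w x + w (1 - x)) and every claim about
     [Hz] becomes one about the sum w x + w (1 - x). *)
  set (w := fun x => (exp ((1 - x) * ln 2) - 1) / dirichlet_eta x).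
  assert (Epos : forall x, 0 < x < 1 -> / 2 < dirichlet_eta x <= / 2 + x) by (intros;
    apply eta_near_0; lra).
  assert (Wpos : forall x, 0 < x < 1 -> 0 < w x).
  { intros x Hx. pose proof (Epos x Hx). destruct (two_pow_gt_1 x Hx) as [_ P].
    apply Rdiv_lt_0_compat; lra. }
  assert (Zw : forall x, 0 < x < 1 -> zeta x = - / w x).
  { intros x Hx. pose proof (Epos x Hx). destruct (two_pow_gt_1 x Hx) as [_ P].
    unfold w. rewrite (eta_zeta zetaC x HC Hx) in *. fold (zeta x) in *.
    set (c := exp _) in *. assert (zeta x <> 0) by (intros E; rewrite E in *; lra).
    field. split; lra. }
  assert (Conv : forall x y t, 0 < x < 1 -> 0 < y < 1 -> x <> y -> 0 < t < 1 ->
    w (t * x + (1 - t) * y) < t * w x + (1 - t) * w y).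
  { intros x y t Hx Hy Hxy Ht. destruct (Rtotal_order x y) as [L|[E|L]]; [|easy|].
    - apply two_pow_div_eta_convex; lra.
    - pose proof (two_pow_div_eta_convex y x (1 - t) ltac:(lra) L ltac:(lra) ltac:(lra)) as H.
      replace ((1 - t) * y + (1 - (1 - t)) * x) with (t * x + (1 - t) * y) in H by ring.
      replace (1 - (1 - t)) with t in H by ring. unfold w. lra. }
  (* Adding this bound at x and 1 - x gives w x + w (1 - x) < 2, which is [Hz x] < - 1. *)
  assert (Wub : forall x, 0 < x < 1 -> w x < 2 * (1 - x)).
  { intros x Hx. pose proof (Epos x Hx). pose proof (two_pow_chord x Hx).
    apply Rlt_div_l; [lra|]. nra. }
  assert (HzE : forall x, 0 < x < 1 -> Hz x = - (2 / (w x + w (1 - x)))).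
  { intros x Hx. pose proof (Wpos x Hx). pose proof (Wpos (1 - x) ltac:(lra)).
    unfold Hz, harmonic_mean. rewrite (Zw x Hx), (Zw (1 - x)) by lra. field. lra. }
  assert (HzS : forall x, Hz (1 - x) = Hz x).
  { intros x. unfold Hz. replace (1 - (1 - x)) with x by ring. apply harmonic_mean_comm. }
  assert (HeS : forall x, He (1 - x) = He x).
  { intros x. unfold He. replace (1 - (1 - x)) with x by ring. apply harmonic_mean_comm. }
  assert (Mid : forall x, 0 < x < 1 -> x <> 1 / 2 -> 2 * w (1 / 2) < w x + w (1 - x)).
  { intros x Hx Hne. pose proof (Conv x (1 - x) (1 / 2) Hx ltac:(lra) ltac:(lra) ltac:(lra)) as H.
    replace (1 / 2 * x + (1 - 1 / 2) * (1 - x)) with (1 / 2) in H by field. lra. }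
  assert (W2 := Wpos (1 / 2) ltac:(lra)).
  assert (Zhalf : zeta (1 / 2) = - (2 / (2 * w (1 / 2)))) by (rewrite Zw by lra; field; lra).
  assert (Ehalf : (1 - sqrt 2) * zeta (1 / 2) = dirichlet_eta (1 / 2)).
  { rewrite (eta_zeta zetaC (1 / 2) HC) by lra. fold zeta. f_equal. f_equal.
    replace ((1 - 1 / 2) * ln 2) with (/ 2 * ln 2) by field.
    change (exp (/ 2 * ln 2)) with (Rpower 2 (/ 2)). symmetry. apply Rpower_sqrt. lra. }
  set (L := ln 2) in *. assert (HL : 693 / 1000 < L < 6932 / 10000) by apply ln2_bounds.
  assert (E4 : ln 4 / (1 + ln 4) = L / (/ 2 + L)) by (rewrite ln_4; fold L; field; lra).
  assert (Elt : forall x, 0 < x < 1 -> dirichlet_eta x < L).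
  { intros x Hx. unfold L. rewrite <- eta_1. apply eta_increasing; lra. }
  (* The limit value is the harmonic mean of 1/2 and L. The harmonic mean increases in each
     argument, so eta may be replaced by its chord values a and b; their sum is fixed at 1/2 + L,
     and their product exceeds the end value L / 2 by (L - 1/2)^2 x (1 - x). *)
  assert (Hlow : forall x, 0 < x < 1 -> L / (/ 2 + L) < He x).
  { intros x Hx. unfold He, harmonic_mean.
    pose proof (eta_chord x Hx) as C1. pose proof (eta_chord (1 - x) ltac:(lra)) as C2.
    replace (1 - (1 - x)) with x in C2 by ring. fold L in C1, C2.
    pose proof (Epos x Hx). pose proof (Epos (1 - x) ltac:(lra)).
    set (e := dirichlet_eta x) in *. set (e' := dirichlet_eta (1 - x)) in *.
    set (a := (1 - x) / 2 + x * L) in *. set (b := x / 2 + (1 - x) * L) in *.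
    assert (Hab : a + b = / 2 + L) by (unfold a, b; field).
    assert (Hm : L / 2 < a * b).
    { replace (a * b) with (L / 2 + (L - / 2) ^ 2 * (x * (1 - x))) by (unfold a, b; field).
      assert (0 < (L - / 2) ^ 2 * (x * (1 - x))); [|lra]. apply Rmult_lt_0_compat; nra. }
    assert (0 < a) by (unfold a; nra). assert (0 < b) by (unfold b; nra).
    apply Rlt_le_trans with (2 * a * b / (a + b)).
    - rewrite Hab. apply Rmult_lt_compat_r; [apply Rinv_0_lt_compat; lra|lra].
    - apply Rle_div_l; [lra|].
      replace (2 * e * e' / (e + e') * (a + b)) with (2 * e * e' * (a + b) / (e + e'))
        by (field; lra).
      apply (Rle_div_r _ _ (e + e')); [lra|].
      assert (a * b * e <= e * e' * a) by (replace (e * e' * a) with (a * e' * e) by ring;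
        apply Rmult_le_compat_r; [lra|]; apply Rmult_le_compat_l; lra).
      assert (a * b * e' <= e * e' * b) by (replace (e * e' * b) with (e * b * e') by ring;
        apply Rmult_le_compat_r; [lra|]; apply Rmult_le_compat_r; lra).
      nra. }
  (* The harmonic mean of two distinct positive numbers is below their arithmetic mean, which
     concavity bounds by the value at 1/2. *)
  assert (Hupp : forall x, 0 < x < 1 -> x <> 1 / 2 -> He x < dirichlet_eta (1 / 2)).
  { intros x Hx Hne. unfold He, harmonic_mean.
    pose proof (Epos x Hx). pose proof (Epos (1 - x) ltac:(lra)).
    assert (dirichlet_eta x <> dirichlet_eta (1 - x) /\
      dirichlet_eta x + dirichlet_eta (1 - x) <= 2 * dirichlet_eta (1 / 2)) as [Ne S].
    { destruct (Rtotal_order x (1 - x)) as [O|[O|O]]; [|lra|].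
      - pose proof (eta_increasing x (1 - x) ltac:(lra) O ltac:(lra)).
        pose proof (eta_concave x (1 - x) (1 / 2) ltac:(lra) O ltac:(lra) ltac:(lra)) as HH.
        replace (1 / 2 * x + (1 - 1 / 2) * (1 - x)) with (1 / 2) in HH by field. lra.
      - pose proof (eta_increasing (1 - x) x ltac:(lra) O ltac:(lra)).
        pose proof (eta_concave (1 - x) x (1 / 2) ltac:(lra) O ltac:(lra) ltac:(lra)) as HH.
        replace (1 / 2 * (1 - x) + (1 - 1 / 2) * x) with (1 / 2) in HH by field. lra. }
    set (e := dirichlet_eta x) in *. set (e' := dirichlet_eta (1 - x)) in *.
    apply Rlt_div_l; [lra|].
    assert (0 < (e - e') ^ 2) by (apply pow2_gt_0; lra). nra. }
  assert (Hhalf : He (1 / 2) = dirichlet_eta (1 / 2)).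
  { unfold He, harmonic_mean. replace (1 - 1 / 2) with (1 / 2) by field.
    pose proof (Epos (1 / 2) ltac:(lra)). field. lra. }
  assert (LimZ : filterlim Hz (at_right 0) (locally (-1))).
  { apply (filterlim_at_right_0_lipschitz _ _ 8). intros x Hx.
    rewrite HzE by lra. pose proof (Wub x ltac:(lra)). pose proof (Wub (1 - x) ltac:(lra)).
    pose proof (Wpos (1 - x) ltac:(lra)).
    (* From 2^(1-x) - 1 > 1 - 2 x and eta x <= 1/2 + x, since (2 - 8 x) (1/2 + x) = 1 - 2 x - 8
       x^2. *)
    assert (2 - 8 * x <= w x).
    { pose proof (Epos x ltac:(lra)). destruct (two_pow_gt_1 x ltac:(lra)) as [P _].
      apply Rle_div_r; [lra|]. fold L in P. nra. }
    set (s := w x + w (1 - x)). assert (2 - 8 * x < s < 2) by (unfold s; lra).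
    replace (- (2 / s) - -1) with (- ((2 - s) / s)) by (field; lra).
    rewrite Rabs_Ropp, Rabs_pos_eq by (apply Rdiv_le_0_compat; lra).
    apply Rle_div_l; [lra|]. nra. }
  assert (LimE : filterlim He (at_right 0) (locally (ln 4 / (1 + ln 4)))).
  { rewrite E4. apply (filterlim_at_right_0_lipschitz _ _ 2). intros x Hx.
    pose proof (Hlow x ltac:(lra)). rewrite Rabs_pos_eq by lra.
    (* Monotonicity of the harmonic mean, with eta x <= 1/2 + x and eta (1 - x) < L, followed by
       dropping x from the denominator. *)
    assert (He x <= 2 * (/ 2 + x) * L / (/ 2 + L)).
    { unfold He, harmonic_mean. pose proof (Epos x ltac:(lra)).
      pose proof (Epos (1 - x) ltac:(lra)).
      pose proof (Elt (1 - x) ltac:(lra)).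
      set (e := dirichlet_eta x) in *. set (e' := dirichlet_eta (1 - x)) in *.
      apply Rle_div_l; [lra|].
      replace (2 * (/ 2 + x) * L / (/ 2 + L) * (e + e')) with (2 * (/ 2 + x) * L * (e + e') /
        (/ 2 + L)) by (field; lra).
      apply (Rle_div_r _ _ (/ 2 + L)); [lra|].
      assert (e * e' <= e * L) by (apply Rmult_le_compat_l; lra).
      assert (e * e' * (/ 2) <= e * L * (/ 2 + x)) by (apply Rmult_le_compat; nra).
      assert (e * e' * L <= (/ 2 + x) * e' * L) by (apply Rmult_le_compat_r; [lra|];
        apply Rmult_le_compat_r; lra).
      nra. }
    assert (2 * (/ 2 + x) * L / (/ 2 + L) = L / (/ 2 + L) + 2 * x * (L / (/ 2 + L))) by (field;
      lra).
    assert (L / (/ 2 + L) <= 1) by (apply Rle_div_l; lra). nra. }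
  split; [|split; split].
  - intros x y t Hx Hy Hxy Ht. pose proof (Conv x y t Hx Hy Hxy Ht).
    assert (R1 : forall x, 0 < x < 1 -> 1 / zeta x = - w x).
    { intros z Hz'. rewrite Zw by easy. pose proof (Wpos z Hz'). field. lra. }
    rewrite !R1; try easy; [lra|nra].
  - intros x Hx. pose proof (Wpos x Hx). pose proof (Wpos (1 - x) ltac:(lra)).
    pose proof (Wub x Hx). pose proof (Wub (1 - x) ltac:(lra)).
    assert (B : Hz x < -1).
    { rewrite HzE by easy. assert (1 < 2 / (w x + w (1 - x))); [|lra].
      apply (Rlt_div_r _ _ (w x + w (1 - x))); lra. }
    assert (I : x <> 1 / 2 -> zeta (1 / 2) < Hz x).
    { intros Hne. rewrite HzE, Zhalf by easy. apply Ropp_lt_contravar.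
      apply Rmult_lt_compat_l; [lra|]. specialize (Mid x Hx Hne). apply Rinv_lt_contravar; nra. }
    assert (J : x = 1 / 2 -> zeta (1 / 2) = Hz x).
    { intros ->. rewrite HzE, Zhalf by lra. replace (1 - 1 / 2) with (1 / 2) by field.
      do 2 f_equal. ring. }
    destruct (Req_dec x (1 / 2)) as [E|E].
    + rewrite <- (J E) in *. repeat split; auto; lra.
    + specialize (I E). repeat split; [lra|easy|lra|easy].
  - split; [exact LimZ|]. now apply filterlim_at_left_1_reflect.
  - intros x Hx. rewrite Ehalf, E4. split; [now apply Hlow|].
    destruct (Req_dec x (1 / 2)) as [->|E].
    + rewrite Hhalf. repeat split; lra.
    + specialize (Hupp x Hx E). repeat split; [lra|lra|easy].
  - split; [exact LimE|]. now apply filterlim_at_left_1_reflect.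
Qed.
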